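(* Let $m\ge 1$, let $\psi\in C^2(\mathbb R^d)$ satisfy $Z_\psi:=\int_{\mathbb R^d}e^{-\psi}dx<+\infty$, and let $d\mu_\psi=Z_\psi^{-1}e^{-\psi}dx$. Let $u=u(x,t)\ge 0$ denote the solution of the weighted porous media equation $$\frac{\partial u}{\partial t}=\Delta u^m-\nabla\psi\cdot\nabla u^m,\qquad t\ge 0,\ x\in\mathbb R^d,$$ with non-negative initial condition $u(\cdot,0)=u_0$. (i) Let $q=2/(m+1)$. If, for some constant $C_P>0$, the $L^q$-Poincaré inequality $$\big[\mathrm{Var}_{\mu_\psi}(f^q)\big]^{1/q}\le C_P\int|\nabla f|^2\,d\mu_\psi\qquad\text{for all non-negative } f\in C^1(\mathbb R^d)$$ holds, then for any initial condition $u_0\in L^2(\mu_\psi)$, $$\forall\,t\ge 0,\qquad \mathrm{Var}_{\mu_\psi}(u(\cdot,t))\le\Big(\big[\mathrm{Var}_{\mu_\psi}(u_0)\big]^{-(m-1)/2}+\frac{4m(m-1)}{(m+1)^2}\,\frac{t}{C_P}\Big)^{-2/(m-1)}.$$ Conversely, if this decay estimate is satisfied for any $u_0$, then the $L^q$-Poincaré inequality holds with constant $C_P$. (ii) Let $q=1/m$. If, for some constant $C_{LS}>0$, the $L^q$-logarithmic Sobolev inequality $$\big[\mathrm{Ent}_{\mu_\psi}(f^{2q})\big]^{1/q}\le C_{LS}\int|\nabla f|^2\,d\mu_\psi\qquad\text{for all non-negative } f\in C^1(\mathbb R^d)$$ holds, then for any non-negative initial condition $u_0$ such that $\mathrm{Ent}_{\mu_\psi}(u_0)<\infty$,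 $$\forall\,t\ge0,\qquad \mathrm{Ent}_{\mu_\psi}(u(\cdot,t))\le\Big(\big[\mathrm{Ent}_{\mu_\psi}(u_0)\big]^{1-m}+\frac{4(m-1)}{m}\,\frac{t}{C_{LS}}\Big)^{-1/(m-1)}.$$ Conversely, if this decay estimate is satisfied for any $u_0$, then the $L^q$-logarithmic Sobolev inequality holds with constant $C_{LS}$. For $m=1$ the right-hand sides are understood as their limits as $m\to1^+$, namely $e^{-2t/C_P}\,\mathrm{Var}_{\mu_\psi}(u_0)$ in (i) and $e^{-4t/C_{LS}}\,\mathrm{Ent}_{\mu_\psi}(u_0)$ in (ii).
   Context: $\mathrm{Var}_\mu(g)=\int g^2d\mu-(\int g\,d\mu)^2$ and $\mathrm{Ent}_\mu(g)=\int g\log\big(g/\int g\,d\mu\big)\,d\mu$ for $g\ge0$. If $\mathrm{Var}_{\mu_\psi}(u_0)=0$ (resp. $\mathrm{Ent}_{\mu_\psi}(u_0)=0$) the right-hand side of the decay estimate is read as $0$. Write $\mathcal L f=\Delta f-\nabla\psi\cdot\nabla f$, so the equation reads $u_t=\mathcal L u^m$. Framework for solutions: for each admissible initial datum (in particular for every positive $u_0\in C^1(\mathbb R^d)\cap L^{m+1}(\mu_\psi)$) the equation has a unique solution $u$, which is the function denoted $u$ in the claim. Solutions are classical and regular and integrable enough, up to and including $t=0$, that $\mathrm{Var}_{\mu_\psi}(u(\cdot,t))$ and $\mathrm{Ent}_{\mu_\psi}(u(\cdot,t))$ may be differentiated in $t$ under the integral sign (from the right at $t=0$) and that the symmetry relation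 $\int f\,\mathcal L g\,d\mu_\psi=-\int\nabla f\cdot\nabla g\,d\mu_\psi$ holds for the functions of $u$ occurring in these derivatives; in particular $\int u(\cdot,t)\,d\mu_\psi$ is conserved. *)

(* Defs.v *)
From HB Require Import structures.
From mathcomp Require Import all_boot all_order all_algebra.
From mathcomp Require Import all_classical all_reals all_analysis.
From mathcomp Require Import measurable_realfun.

Set Implicit Arguments.
Unset Strict Implicit.
Unset Printing Implicit Defensive.
Import Order.TTheory GRing.Theory Num.Theory.
Import numFieldNormedType.Exports.
Local Open Scope classical_set_scope.
Local Open Scope ring_scope.

Fact rV_borel_display : measure_display. Proof. exact. Qed.

Section rV_borel.
Variables (R : realType) (d : nat).

Definition rV_measurable : set (set 'rV[R]_d) := <<s [set A | open A] >>.

Lemma rV_measurable0 : rV_measurable set0.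
Proof. exact: sigma_algebra0. Qed.

Lemma rV_measurableC A : rV_measurable A -> rV_measurable (~` A).
Proof. by move=> mA; rewrite -setTD; exact: sigma_algebraCD. Qed.

Lemma rV_measurable_bigcup (F : (set 'rV[R]_d)^nat) :
  (forall i, rV_measurable (F i)) -> rV_measurable (\bigcup_i F i).
Proof. exact: sigma_algebra_bigcup. Qed.

HB.instance Definition _ := @isMeasurable.Build rV_borel_display 'rV[R]_d
  rV_measurable rV_measurable0 rV_measurableC rV_measurable_bigcup.

Lemma rV_open_measurable (A : set 'rV[R]_d) : open A -> measurable A.
Proof. by move=> oA; exact: sub_sigma_algebra. Qed.

Lemma continuous_rV_measurable (f : 'rV[R]_d -> R) :
  continuous f -> measurable_fun setT f.
Proof.
move=> cf; apply: (measurability _ (RGenOpens.measurableE R)).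
move=> _ [_ [a [b ->] <-]]; rewrite setTI; apply: rV_open_measurable.
by move/continuousP: cf; apply; exact: interval_open.
Qed.

Lemma measurable_rV (d' : measure_display) (T : measurableType d')
    (f : T -> 'rV[R]_d) :
  (forall i, measurable_fun setT (fun x => f x 0 i)) -> measurable_fun setT f.
Proof.
move=> mf.
have mball (q : 'rV[R]_d) (e : R) : measurable (f @^-1` ball q e).
  have [e0|e0] := ltP 0 e; last first.
    rewrite (_ : _ @^-1` _ = set0) // -subset0 => x [/=].
    by rewrite ltNge e0.
  rewrite (_ : _ @^-1` _ =
      \bigcap_(i in [set: 'I_d]) ((fun x => f x 0 i) @^-1` ball (q 0 i) e)).
    apply: fin_bigcap_measurable => // i _; rewrite -[X in measurable X]setTI.
    by apply: mf => //; apply: open_measurable; exact: ball_open.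
  apply/seteqP; split => x /=.
    by move=> [_ h] i _; exact: h.
  by move=> h; split => // i j; rewrite ord1; exact: h.
apply: (measurability [set A : set 'rV[R]_d | open A]) => //.
move=> _ [A oA <-]; rewrite setTI.
pose B (p : 'rV[rat]_d * nat) : set T :=
  if `[< ball (map_mx ratr p.1 : 'rV[R]_d) p.2.+1%:R^-1 `<=` A >]
  then f @^-1` ball (map_mx ratr p.1 : 'rV[R]_d) p.2.+1%:R^-1 else set0.
rewrite (_ : _ @^-1` _ = \bigcup_p B p).
  apply: countable_bigcupT_measurable; first exact: countableP.
  by move=> p; rewrite /B; case: ifP.
apply/seteqP; split => x /=; last first.
  by move=> [p _]; rewrite /B; case: asboolP => // sA /sA.
move=> Afx.
have /nbhs_ballP[e /= e0 sA] : nbhs (f x) A by exact: open_nbhs_nbhs.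
have [n ne] : exists n, n.+1%:R^-1 < e / 2.
  have e20 : 0 < e / 2 by rewrite divr_gt0.
  have [n _ /(_ n) h] := near_infty_natSinv_lt (PosNum e20).
  by exists n; exact: (h (leqnn n)).
pose q := \row_i xget 0 [set r : rat | ball (f x 0 i) n.+1%:R^-1 (ratr r : R)].
have qP i : ball (f x 0 i) n.+1%:R^-1 (ratr (q 0 i) : R).
  rewrite mxE.
  have [r rP] : exists r : rat, ball (f x 0 i) n.+1%:R^-1 (ratr r : R).
    have /rat_in_itvoo[r] : f x 0 i - n.+1%:R^-1 < f x 0 i + n.+1%:R^-1.
      by rewrite ltrBlDr -addrA ltrDl.
    rewrite in_itv/= => /andP[r1 r2]; exists r.
    by rewrite /ball/= ltr_distlC r1 r2.
  by have := @xgetPex _ 0 [set r : rat | ball (f x 0 i) n.+1%:R^-1 (ratr r : R)]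
    (ex_intro _ r rP).
exists (q, n) => //; rewrite /B asboolT /=.
  split=> [|i j]; first by rewrite invr_gt0.
  by rewrite ord1 mxE; apply: ball_sym; exact: qP.
move=> y [_ hy]; apply: sA; split => // i j.
have -> : e = e / 2 + e / 2 by rewrite -splitr.
apply: (@ball_triangle _ _ (ratr (q i j) : R)).
  by rewrite ord1; apply: le_ball (qP j); exact: ltW.
by have := hy i j; rewrite mxE; apply: le_ball; exact: ltW.
Qed.

End rV_borel.

Section lebesgue_rV.
Variable R : realType.

Section step.
Variable d : nat.

Definition rV_cons (z : R * 'rV[R]_d) : 'rV[R]_d.+1 := row_mx z.1%:M z.2.

Lemma rV_cons0 z : rV_cons z 0 0 = z.1.
Proof.
have -> : 0 = lshift d (0 : 'I_1) :> 'I_(1 + d) by exact/val_inj.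
by rewrite (@row_mxEl _ 1 1 d) !mxE.
Qed.

Lemma rV_consS z i : rV_cons z 0 (lift ord0 i) = z.2 0 i.
Proof.
have -> : lift ord0 i = rshift 1 i :> 'I_(1 + d) by exact/val_inj.
by rewrite (@row_mxEr _ 1 1 d).
Qed.

Lemma measurable_rV_cons : measurable_fun setT rV_cons.
Proof.
apply: measurable_rV => i; have [j ->|->] := unliftP ord0 i; last first.
  apply: (eq_measurable_fun fst); last exact: measurable_fst.
  by move=> z _; rewrite rV_cons0.
apply: (eq_measurable_fun (fun z : R * 'rV[R]_d => z.2 0 j)).
  by move=> z _; rewrite rV_consS.
apply: (@measurableT_comp _ _ _ _ _ _ (fun v : 'rV[R]_d => v 0 j)) => //.
by apply: continuous_rV_measurable; exact: coord_continuous.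
Qed.

Variable m : {sigma_finite_measure set 'rV[R]_d -> \bar R}.

Let leb_step : set 'rV[R]_d.+1 -> \bar R :=
  pushforward (@lebesgue_measure R \x m)%E rV_cons.

Let mcons := measurable_rV_cons.

Let leb_step0 : leb_step set0 = 0%E.
Proof. exact: measure0. Qed.

Let leb_step_ge0 A : (0 <= leb_step A)%E.
Proof. exact: measure_ge0. Qed.

Let leb_step_sigma_additive : semi_sigma_additive leb_step.
Proof. exact: measure_semi_sigma_additive. Qed.

HB.instance Definition _ := isMeasure.Build _ _ _ leb_step
  leb_step0 leb_step_ge0 leb_step_sigma_additive.

Let leb_step_sigma_finite : sigma_finite setT leb_step.
Proof.
have /sigma_finiteP[F1 [TF1 ndF1 F1oo]] :=
  sigma_finiteT (@lebesgue_measure R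
    : {sigma_finite_measure set (measurableTypeR R) -> \bar R}).
have /sigma_finiteP[F2 [TF2 ndF2 F2oo]] := sigma_finiteT m.
pose F n := F1 n `*` F2 n.
have TF : [set: R * 'rV[R]_d] = \bigcup_n F n.
  rewrite -setXTT TF1 TF2 predeqE => -[x y]; split.
    move=> [/= [n _ Fnx] [k _ Gky]]; exists (maxn n k) => //; split.
    - by move: x Fnx; exact/subsetPset/ndF1/leq_maxl.
    - by move: y Gky; exact/subsetPset/ndF2/leq_maxr.
  by move=> [n _ []/= ? ?]; split; exists n.
have Foo n : measurable (F n) /\ ((@lebesgue_measure R \x m) (F n) < +oo)%E.
  have [? ?] := F1oo n; have [? ?] := F2oo n.
  split; first exact: measurableX.
  by rewrite product_measure1E// lte_mul_pinfty// ge0_fin_numE.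
pose g (w : 'rV[R]_d.+1) : R * 'rV[R]_d :=
  (w 0 0, \row_i w 0 (lift ord0 i)).
have gK z : g (rV_cons z) = z.
  rewrite /g rV_cons0 [RHS]surjective_pairing; congr pair.
  by apply/rowP => i; rewrite mxE rV_consS.
have mg : measurable_fun setT g.
  apply/measurable_fun_pairP; split => /=.
    by apply: continuous_rV_measurable; exact: coord_continuous.
  apply: measurable_rV => i.
  apply: (eq_measurable_fun (fun w : 'rV[R]_d.+1 => w 0 (lift ord0 i))).
    by move=> w _; rewrite /= mxE.
  by apply: continuous_rV_measurable; exact: coord_continuous.
exists (fun n => g @^-1` F n).
  by rewrite -preimage_bigcup -TF preimage_setT.
move=> n; have [mF Fn] := Foo n; split.
  by rewrite -[X in measurable X]setTI; exact: mg.
rewrite /leb_step /pushforward -comp_preimage.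
by rewrite (_ : g \o rV_cons = id) //; apply/funext => z; exact: gK.
Qed.

HB.instance Definition _ := Measure_isSigmaFinite.Build _ _ _ leb_step
  leb_step_sigma_finite.

Definition lebesgue_rV_step : {sigma_finite_measure set 'rV[R]_d.+1 -> \bar R} :=
  leb_step.

End step.

Fixpoint lebesgue_rV d : {sigma_finite_measure set 'rV[R]_d -> \bar R} :=
  if d is d'.+1 then lebesgue_rV_step (lebesgue_rV d') else dirac (0 : 'rV[R]_0).

Lemma lebesgue_rV_box d (a b : 'rV[R]_d) : (forall i, a 0 i <= b 0 i) ->
  lebesgue_rV d [set x : 'rV[R]_d | forall i, a 0 i <= x 0 i <= b 0 i] =
  (\prod_(i < d) (b 0 i - a 0 i))%:E.
Proof.
elim: d a b => [|d IH] a b ab.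
  by rewrite big_ord0 /= diracE mem_set// => -[].
pose a' : 'rV[R]_d := \row_j a 0 (lift ord0 j).
pose b' : 'rV[R]_d := \row_j b 0 (lift ord0 j).
transitivity ((@lebesgue_measure R \x lebesgue_rV d)%E (`[a 0 0, b 0 0] `*`
    [set x : 'rV[R]_d | forall i, a' 0 i <= x 0 i <= b' 0 i])).
  rewrite /= /pushforward; congr (_ _); apply/seteqP; split => -[r v] /=.
    move=> h; split; first by have := h 0; rewrite rV_cons0 in_itv.
    by move=> i; have := h (lift ord0 i); rewrite rV_consS !mxE.
  rewrite in_itv => -[h0 h] i; have [j ->|->] := unliftP ord0 i.
    by have := h j; rewrite rV_consS !mxE.
  by rewrite rV_cons0.
have ab' i : a' 0 i <= b' 0 i by rewrite !mxE.
rewrite product_measure1E//.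
- rewrite IH//= big_ord_recl EFinM; congr (_ * _)%E; last first.
    by congr EFin; apply: eq_bigr => i _; rewrite !mxE.
  etransitivity; first exact: lebesgue_measure_itv.
  rewrite /= lte_fin; have := ab 0; rewrite le_eqVlt => /predU1P[->|->//].
  by rewrite ltxx subrr.
- rewrite (_ : [set x : 'rV[R]_d | _] = \bigcap_(i in [set: 'I_d])
      ((fun x : 'rV[R]_d => x 0 i) @^-1` `[a' 0 i, b' 0 i])).
    apply: fin_bigcap_measurable => // i _; rewrite -[X in measurable X]setTI.
    by apply: (continuous_rV_measurable (@coord_continuous _ _ _ 0 i)).
  by apply/seteqP; split => [x h i _|x h i]; have := h i; rewrite /= in_itv; exact.
Qed.
End lebesgue_rV.

Section calculus.
Variables (R : realType) (d : nat).
Implicit Types f g psi : 'rV[R]_d -> R.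

(* The library norm of ['rV[R]_d] is the sup norm, whence the explicit
   Euclidean scalar product. *)
Definition dotv (v w : 'rV[R]_d) : R := \sum_(i < d) v 0 i * w 0 i.

Definition grad f (x : 'rV[R]_d) : 'rV[R]_d :=
  \row_i 'D_(delta_mx 0 i) f x.

Definition laplacian f (x : 'rV[R]_d) : R :=
  \sum_(i < d) 'D_(delta_mx 0 i) (fun y => grad f y 0 i) x.

Definition C1 f := (forall x, differentiable f x) /\ continuous (grad f).

Definition C2 f := C1 f /\ forall i, C1 (fun x => grad f x 0 i).

Definition witten_laplacian psi f (x : 'rV[R]_d) : R :=
  laplacian f x - dotv (grad psi x) (grad f x).

Lemma C1_continuous f : C1 f -> continuous f.
Proof. by case=> df _ x; exact/differentiable_continuous/df. Qed.

Lemma C2_measurable f : C2 f -> measurable_fun setT f.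
Proof. by case=> /C1_continuous cf _; exact: continuous_rV_measurable. Qed.

End calculus.

Section gibbs.
Variables (R : realType) (d : nat).

Definition partition_function (psi : 'rV[R]_d -> R) : \bar R :=
  (\int[lebesgue_rV R d]_x (expR (- psi x))%:E)%E.

(* The proof that [psi] is C2 is only used to know that the density is
   measurable. *)
Definition gibbs (psi : 'rV[R]_d -> R) (psiC2 : C2 psi) (A : set 'rV[R]_d) :=
  (\int[lebesgue_rV R d]_(x in A)
     ((fine (partition_function psi))^-1 * expR (- psi x))%:E)%E.

Variables (psi : 'rV[R]_d -> R) (psiC2 : C2 psi).

Let density_ge0 x :
  0 <= (fine (partition_function psi))^-1 * expR (- psi x).
Proof.
rewrite mulr_ge0 ?expR_ge0// invr_ge0 fine_ge0// integral_ge0//.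
Qed.

Let gibbs0 : gibbs psiC2 set0 = 0%E.
Proof. by rewrite /gibbs integral_set0. Qed.

Let gibbs_ge0 A : (0 <= gibbs psiC2 A)%E.
Proof. by apply: integral_ge0 => x _; rewrite lee_fin. Qed.

Let gibbs_sigma_additive : semi_sigma_additive (gibbs psiC2).
Proof.
move=> F mF tF mUF; rewrite /gibbs ge0_integral_bigcup//.
- by apply: is_cvg_nneseries => n _ _; exact: gibbs_ge0.
- apply/measurable_EFinP/measurable_funTS/measurable_funM => //.
  apply: measurableT_comp => //; apply: measurableT_comp => //.
  exact: C2_measurable.
- by move=> x _; rewrite lee_fin.
Qed.

HB.instance Definition _ := isMeasure.Build _ _ _ (gibbs psiC2)
  gibbs0 gibbs_ge0 gibbs_sigma_additive.

End gibbs.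

Section var_ent.
Local Open Scope ereal_scope.
Context (dT : measure_display) (T : measurableType dT) (R : realType).
Variable mu : {measure set T -> \bar R}.

(* [+oo] when [g] is not square integrable (resp. not integrable). *)
Definition Var (g : T -> R) : \bar R :=
  let g2 := \int[mu]_x (g x ^+ 2)%:E in
  if g2 == +oo then +oo else g2 - (\int[mu]_x (g x)%:E) ^+ 2.

Definition Ent (g : T -> R) : \bar R :=
  let m := \int[mu]_x (g x)%:E in
  if m == +oo then +oo else \int[mu]_x (g x * ln (g x / fine m))%:E.

End var_ent.

Section inequalities.
Variables (R : realType) (d : nat) (mu : {measure set 'rV[R]_d -> \bar R}).

Definition Lq_poincare (q C : R) : Prop :=
  forall f : 'rV[R]_d -> R, C1 f -> (forall x, 0 <= f x) ->
  (Var mu (fun x => (f x `^ q)%R) `^ q^-1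
     <= C%:E * \int[mu]_x (dotv (grad f x) (grad f x))%:E)%E.

Definition Lq_logsobolev (q C : R) : Prop :=
  forall f : 'rV[R]_d -> R, C1 f -> (forall x, 0 <= f x) ->
  (Ent mu (fun x => (f x `^ (2 * q))%R) `^ q^-1
     <= C%:E * \int[mu]_x (dotv (grad f x) (grad f x))%:E)%E.

End inequalities.

Section solutions.
Variables (R : realType) (d : nat) (psi : 'rV[R]_d -> R) (psiC2 : C2 psi).
Variable m : R.
Let mu : {measure set 'rV[R]_d -> \bar R} := gibbs psiC2.

Definition powm (v : 'rV[R]_d -> R) (x : 'rV[R]_d) : R := v x `^ m.

(* [int phi (u t) dmu] may be differentiated under the integral sign, and the
   symmetry relation for the generator holds for [phi' (u t)] and [(u t)^m].
   As mass is conserved, [phi s = s ^ 2] and [phi s = s ln s] amount to the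
   variance and to the entropy of [u t].  At [t = 0] the datum is at best C1,
   so that [L (u 0)^m] only makes sense through the symmetry relation: the
   derivative from the right at [0] is the one given by that relation, when
   its integral converges. *)
Record differentiable_functional (phi phi' : R -> R) (u : R -> 'rV[R]_d -> R)
    : Prop := DifferentiableFunctional {
  df_integrable : forall t : R, 0 <= t ->
    mu.-integrable setT (fun x => (phi (u t x))%:E);
  df_cvg0 : (\int[mu]_x phi (u t x)) @[t --> 0^'+] --> \int[mu]_x phi (u 0 x);
  df_dt_integrable : forall t : R, 0 < t ->
    mu.-integrable setT (fun x => (phi' (u t x) * 'D_1 (u ^~ x) t)%:E);
  df_derive : forall t : R, 0 < t ->
    is_derive t 1 (fun s : R => \int[mu]_x phi (u s x))
      (\int[mu]_x (phi' (u t x) * 'D_1 (u ^~ x) t));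
  df_grad_integrable : forall t : R, 0 < t ->
    mu.-integrable setT
      (fun x => (dotv (grad (phi' \o u t) x) (grad (powm (u t)) x))%:E);
  df_symmetry : forall t : R, 0 < t ->
    \int[mu]_x (phi' (u t x) * witten_laplacian psi (powm (u t)) x) =
    - \int[mu]_x dotv (grad (phi' \o u t) x) (grad (powm (u t)) x);
  df_right_derive0 : C1 (u 0) -> (forall x, 0 < u 0 x) ->
    mu.-integrable setT
      (fun x => (dotv (grad (phi' \o u 0) x) (grad (powm (u 0)) x))%:E) ->
    (h^-1 * (\int[mu]_x phi (u h x) - \int[mu]_x phi (u 0 x)))
      @[h --> 0^'+] -->
    - \int[mu]_x dotv (grad (phi' \o u 0) x) (grad (powm (u 0)) x)
}.

Record pme_solution (u0 : 'rV[R]_d -> R) (u : R -> 'rV[R]_d -> R) : Prop :=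
  PmeSolution {
  pme_ge0 : forall (t : R) x, 0 <= t -> 0 <= u t x;
  pme_init : u 0 = u0;
  pme_C1 : forall t : R, 0 < t -> C1 (u t);
  pme_C2 : forall t : R, 0 < t -> C2 (powm (u t));
  pme_dt : forall (t : R) x, 0 < t -> derivable (u ^~ x) t 1;
  pme_eq : forall (t : R) x, 0 < t ->
    'D_1 (u ^~ x) t = witten_laplacian psi (powm (u t)) x;
  pme_integrable : forall t : R, 0 <= t ->
    mu.-integrable setT (fun x => (u t x)%:E);
  pme_mass : forall t : R, 0 <= t -> \int[mu]_x u t x = \int[mu]_x u0 x;
  pme_cvg0 : (\int[mu]_x `|u t x - u0 x|) @[t --> 0^'+] --> (0 : R);
  pme_var : u0 \in Lfun mu 2%:E ->
    differentiable_functional (fun s => s ^+ 2) (fun s => 2 * s) u;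
  pme_ent : (Ent mu u0 < +oo)%E ->
    differentiable_functional (fun s => s * ln s) (fun s => ln s + 1) u
}.

(* [adm] is the class of admissible initial data; solutions are compared for
   nonnegative times only, the values at [t < 0] being irrelevant. *)
Record pme_framework (adm : set ('rV[R]_d -> R)) : Prop := PmeFramework {
  pme_adm : forall u0, C1 u0 -> (forall x, 0 < u0 x) ->
    u0 \in Lfun mu (m + 1)%:E -> adm u0;
  pme_existence : forall u0, adm u0 -> exists u, pme_solution u0 u;
  pme_uniqueness : forall u0 u v, adm u0 ->
    pme_solution u0 u -> pme_solution u0 v ->
    forall (t : R) x, 0 <= t -> u t x = v t x
}.

End solutions.

Section rates.
Variable R : realType.
Implicit Types m C V E t : R.

(* The last branch is meaningless for [V = 0], where [0] is raised to a negative
   power, and for [m = 1], where its limit as [m] tends to [1] is taken. *)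
Definition var_bound m C V t : R :=
  if V == 0 then 0
  else if m == 1 then expR (- (2 * t / C)) * V
  else (V `^ (- ((m - 1) / 2)) + 4 * m * (m - 1) / (m + 1) ^+ 2 * (t / C))
         `^ (- (2 / (m - 1))).

Definition ent_bound m C E t : R :=
  if E == 0 then 0
  else if m == 1 then expR (- (4 * t / C)) * E
  else (E `^ (1 - m) + 4 * (m - 1) / m * (t / C)) `^ (- (1 / (m - 1))).

End rates.

Section decay.
Variables (R : realType) (d : nat) (psi : 'rV[R]_d -> R) (psiC2 : C2 psi).
Variables (m : R) (adm : set ('rV[R]_d -> R)).
Let mu : {measure set 'rV[R]_d -> \bar R} := gibbs psiC2.

Definition var_decay (C : R) : Prop :=
  forall u0 u, adm u0 -> u0 \in Lfun mu 2%:E -> pme_solution psiC2 m u0 u ->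
  forall t : R, 0 <= t ->
  (Var mu (u t) <= (var_bound m C (fine (Var mu u0)) t)%:E)%E.

Definition ent_decay (C : R) : Prop :=
  forall u0 u, adm u0 -> (Ent mu u0 < +oo)%E -> pme_solution psiC2 m u0 u ->
  forall t : R, 0 <= t ->
  (Ent mu (u t) <= (ent_bound m C (fine (Ent mu u0)) t)%:E)%E.

End decay.

(* Main.v *)
Require Import Defs.
From HB Require Import structures.
From mathcomp Require Import all_boot all_order all_algebra.
From mathcomp Require Import all_classical all_reals all_analysis.
From mathcomp Require Import measurable_realfun ring lra.
Set Implicit Arguments.
Unset Strict Implicit.
Unset Printing Implicit Defensive.
Import Order.TTheory GRing.Theory Num.Theory.
Import numFieldNormedType.Exports.
Local Open Scope classical_set_scope.
Local Open Scope ring_scope.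

(* Both functionals have the form gap(g) = int phi(g) - phi(int g), with
   phi(s) = s^2 or phi(s) = s ln s.  Along the flow the mass is conserved and
   (d/dt) gap(u) = - int <grad phi'(u), grad u^m>, which is - kappa int |grad f|^2
   for f^p = u (p = 2/(m+1) or 2/m).  The L^q inequality therefore turns into
   y' <= - (kappa / C) y^(1+a), whose integration is the decay estimate; for the
   entropy with m < 2 the function u^(m/2) is not C1 where u vanishes, and one
   uses (u + e)^(m/2) and lets e tend to 0.  Conversely, for f bounded and bounded
   away from 0, comparing the right derivatives at t = 0 of both sides of the
   decay estimate gives the inequality, and a truncation reaches every f: the
   gap is lower semicontinuous by Fatou's lemma applied to the Bregman divergence
   phi(s) - phi(M) - phi'(M)(s - M). *)

(** Both parts are instances of one argument with parameters [phi], [p], [r], [a], [kappa], where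
    [r] is 1/q and [a] is r - 1. The values are s^2, 2/(m+1), (m+1)/2, (m-1)/2, 8m/(m+1)^2 for the
    variance and s ln s, 2/m, m, m-1, 4/m for the entropy. The constant [kappa] makes phi''(s) m
    s^(m-1) equal to kappa times the square of the derivative of s^(1/p). Two obstacles shape the
    proof. Where u vanishes, the logarithm and low powers cannot be differentiated; but such a point
    is a minimum of u, so grad u = 0 there, and only an exponent 1/p < 1, which spoils the C1
    regularity of u^(1/p), calls for a shift. In the converse, f^p is not known to be integrable,
    and if it were not, the left-hand side would be infinite: finiteness of the mean has to come out
    of the bound on the gaps of the truncations. *)

Section decay_rate.
Variable R : realType.
Implicit Types (a k y t : R).

(** The solution at time [t] of the equation y' = - k y^(1+a) with initial value [y]. The value 0 is
    split off because a negative power of 0 would not be read as infinity. *)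
Definition decay_rate a k y t : R :=
  if y == 0 then 0
  else if a == 0 then expR (- (k * t)) * y
  else (y `^ (- a) + a * (k * t)) `^ (- a^-1).

Lemma decay_rate_ge0 a k y t : 0 <= y -> 0 <= decay_rate a k y t.
Proof.
move=> y0; rewrite /decay_rate; case: ifP => // _; case: ifP => _.
  by rewrite mulr_ge0// expR_ge0.
exact: powR_ge0.
Qed.

Lemma powR_oppVK a y : a != 0 -> 0 <= y -> (y `^ (- a)) `^ (- a^-1) = y.
Proof.
by move=> a0 y0; rewrite -powRrM mulrNN divff// powRr1.
Qed.

Lemma decay_rate_init a k y : 0 <= y -> decay_rate a k y 0 = y.
Proof.
move=> y0; rewrite /decay_rate !mulr0 oppr0 expR0 mul1r addr0.
case: eqP => [->//|_]; case: eqP => // /eqP a0.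
exact: powR_oppVK.
Qed.

Lemma is_derive1_continuous (f : R -> R) (x df : R) :
  is_derive x 1 f df -> {for x, continuous f}.
Proof. by move=> [/derivable1_diffP/differentiable_continuous]. Qed.

Lemma derive_le0_nonincreasing (f f' : R -> R) (s t : R) : s <= t ->
  (forall r : R, s <= r <= t -> is_derive r 1 f (f' r)) ->
  (forall r : R, s <= r <= t -> f' r <= 0) -> f t <= f s.
Proof.
move=> st df f'0.
have cE r : r \in `]s, t[ -> s <= r <= t.
  by rewrite in_itv/= => /andP[/ltW -> /ltW ->].
apply: (@ler0_derive1_le_cc _ f s t) => //.
- by move=> r /cE /df [].
- by move=> r /cE rst; rewrite derive1E (@derive_val _ _ _ _ _ _ _ (df _ rst)) f'0.
- apply: derivable_within_continuous => r; rewrite in_itv/= => /df [] //.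
- by rewrite in_itv/= lexx st.
- by rewrite in_itv/= lexx st.
Qed.

(** Along the flow the functional is differentiable at positive times only, so monotonicity is
    applied on [s, t] and [s] tends to 0: the limit [l] replaces the value at 0. *)
Lemma is_derive_le0_cvg0 (f f' : R -> R) (l t : R) : 0 < t ->
  (forall r : R, 0 < r <= t -> is_derive r 1 f (f' r)) ->
  (forall r : R, 0 < r <= t -> f' r <= 0) ->
  f r @[r --> 0^'+] --> l -> f t <= l.
Proof.
move=> t0 df f'0 fl; apply: (cvgr_to_ge fl).
near=> s.
have s0 : 0 < s by near: s; exact: nbhs_right_gt.
have st : s <= t by near: s; exact: nbhs_right_le.
by apply: (@derive_le0_nonincreasing f f') => // r /andP[sr rt];
  [apply: df|apply: f'0]; rewrite (lt_le_trans s0 sr).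
Unshelve. all: by end_near. Qed.

(** If [y t] is 0 the bound is trivial. Otherwise [y], being nonincreasing, is positive on [0, t],
    and the differential inequality says that ln y + k s (for [a = 0]) or a k s - y^(-a) (for
    [a > 0]) is nonincreasing. *)
Lemma le_decay_rate (a k : R) (y y' : R -> R) (t : R) : 0 <= a -> 0 <= k -> 0 <= t ->
  (forall s : R, 0 <= s -> 0 <= y s) ->
  (forall s : R, 0 < s -> is_derive s 1 y (y' s)) ->
  (forall s : R, 0 < s -> y' s <= - (k * y s `^ (1 + a))) ->
  y s @[s --> 0^'+] --> y 0 ->
  y t <= decay_rate a k (y 0) t.
Proof.
move=> a0 k0 t0 y0 dy y'le yc.
move: t0; rewrite le_eqVlt => /predU1P[<-|t0].
  by rewrite decay_rate_init// y0.
have y'0 s : 0 < s -> y' s <= 0.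
  by move=> s0; rewrite (le_trans (y'le _ s0))// oppr_le0 mulr_ge0// powR_ge0.
have := y0 _ (ltW t0); rewrite le_eqVlt => /predU1P[<-|yt0].
  by apply: decay_rate_ge0; exact: y0.
have ytle s : 0 < s <= t -> y t <= y s.
  move=> /andP[s0 st]; apply: (@derive_le0_nonincreasing y y') => // r /andP[sr rt];
    [apply: dy|apply: y'0]; exact: lt_le_trans sr.
have ys0 s : 0 < s <= t -> 0 < y s by move=> st; exact: lt_le_trans (ytle _ st).
have y00 : 0 < y 0.
  apply: (lt_le_trans yt0); apply: (@is_derive_le0_cvg0 y y') => // r /andP[r0 _].
    exact: dy.
  exact: y'0.
rewrite /decay_rate gt_eqF//; case: eqP => [a_0|/eqP aN0].
  have cl : ln (y s) + k * s @[s --> 0^'+] --> ln (y 0) + k * 0.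
    apply: cvgD; first by apply: (continuous_cvg _ (is_derive1_continuous (is_derive1_ln y00)) yc).
    apply: cvgM; first exact: cvg_cst.
    exact: cvg_at_right_filter (@cvg_id _ _).
  have := @is_derive_le0_cvg0 _ (fun s => (y s)^-1 * y' s + k) _ _ t0 _ _ cl.
  rewrite mulr0 addr0 => H.
  rewrite -[y t]lnK ?posrE// -[X in _ * X]lnK ?posrE// -expRD ler_expR.
  rewrite addrC lerBrDr; apply: H => r rt.
    apply: is_deriveD; first exact: (is_derive1_comp (is_derive1_ln (ys0 _ rt)) (dy _ (proj1 (andP rt)))).
    by apply: is_derive_eq; rewrite /GRing.scale/= mulr1.
  have yr := ys0 _ rt; have /andP[r0 _] := rt.
  rewrite -lerBrDr sub0r mulrC ler_pdivrMr// (le_trans (y'le _ r0))//.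
  by rewrite a_0 addr0 powRr1 ?mulNr// ltW.
have ap : 0 < a by rewrite lt_neqAle eq_sym aN0.
have cl : - (y s) `^ (- a) + a * (k * s) @[s --> 0^'+] --> - (y 0) `^ (- a) + a * (k * 0).
  apply: cvgD; first apply: cvgN.
    by apply: (continuous_cvg _ (is_derive1_continuous (is_derive1_powR (- a) y00)) yc).
  apply: cvgM; first exact: cvg_cst.
  apply: cvgM; first exact: cvg_cst.
  exact: cvg_at_right_filter (@cvg_id _ _).
have := @is_derive_le0_cvg0 _ (fun s => - (- a * (y s) `^ (- a - 1) * y' s) + a * k) _ _ t0 _ _ cl.
rewrite !mulr0 addr0 => H.
rewrite -(@powR_oppVK a (y t))// ?(ltW yt0)// !(powRN _ a^-1).
rewrite lef_pV2 ?posrE ?powR_gt0//; last first.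
  by rewrite ltr_pwDl// ?powR_gt0// !mulr_ge0// ltW.
apply: ge0_ler_powR; rewrite ?invr_ge0 ?nnegrE ?addr_ge0 ?powR_ge0 ?mulr_ge0 ?(ltW t0)//.
rewrite -lerBrDr -[leLHS]opprK lerNl opprB addrC; apply: H => r rt.
  apply: is_deriveD.
    apply: is_deriveN; exact: (is_derive1_comp (is_derive1_powR (-a) (ys0 _ rt)) (dy _ (proj1 (andP rt)))).
  by apply: is_derive_eq; rewrite /GRing.scale/= mulr1.
have yr := ys0 _ rt; have /andP[r0 _] := rt.
have -> : - (- a * y r `^ (- a - 1) * y' r) + a * k = a * (y r `^ (- a - 1) * y' r + k) by ring.
rewrite pmulr_rle0// -lerBrDr sub0r.
apply: (le_trans (ler_wpM2l (powR_ge0 _ _) (y'le _ r0))).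
rewrite mulrN mulrCA -powRD ?(gt_eqF yr) ?implybT//.
by rewrite (_ : - a - 1 + (1 + a) = 0) ?powRr0 ?mulr1//; ring.
Qed.

Lemma is_derive_at_right (f : R -> R) (df : R) : is_derive (0 : R) 1 f df ->
  h^-1 * (f h - f 0) @[h --> 0^'+] --> df.
Proof.
move=> [fd <-].
have /cvg_dnbhs_at_right := fd; apply: cvg_trans; apply: near_eq_cvg.
by near=> h; rewrite /= addr0 [_%:A]mulr1.
Unshelve. all: by end_near. Qed.

(** The closed form solves y' = - k y^(1+a). As [y] is positive, the base of the power is positive
    at time 0, so the formula even has a two-sided derivative there. *)
Lemma decay_rate_right_derivative a k y : 0 <= a -> 0 < y ->
  h^-1 * (decay_rate a k y h - y) @[h --> 0^'+] --> - (k * y `^ (1 + a)).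
Proof.
move=> a0 y0.
suff : is_derive (0 : R) 1 (decay_rate a k y) (- (k * y `^ (1 + a))).
  by move=> /is_derive_at_right; rewrite decay_rate_init// ltW.
rewrite /decay_rate gt_eqF//; case: eqP => [->|/eqP aN0].
  rewrite addr0 powRr1 ?ltW//.
  have dk : is_derive (0 : R) 1 (fun t => - (k * t)) (- k).
    by apply: is_derive_eq; rewrite /GRing.scale/= mulr1.
  have d1 : is_derive (0 : R) 1 (fun t => expR (- (k * t))) (expR (- (k * 0)) * - k).
    exact: (is_derive1_comp (is_derive_expR _) dk).
  apply: (is_derive_eq (is_deriveM d1 (is_derive_cst y _ _))).
  by rewrite /cst mulr0 oppr0 expR0 /GRing.scale/= mulr0 add0r mul1r mulrN mulrC.
have dk : is_derive (0 : R) 1 (fun t => y `^ (- a) + a * (k * t)) (a * k).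
  rewrite -[a * k]add0r; apply: is_deriveD.
  by apply: is_derive_eq; rewrite /GRing.scale/= mulr1.
have yp : 0 < y `^ (- a) + a * (k * 0) by rewrite !mulr0 addr0 powR_gt0.
apply: (is_derive_eq (@is_derive1_comp _ (powR (R:=R) ^~ (- a^-1))
  (fun t => y `^ (- a) + a * (k * t)) _ _ _ (is_derive1_powR (- a^-1) yp) dk)).
rewrite !mulr0 addr0 -powRrM.
have -> : - a * (- a^-1 - 1) = 1 + a by field.
by field.
Qed.

End decay_rate.

(** * Gradients, chain rule and powers of nonnegative C1 functions *)

Section calculus.
Variables (R : realType) (d : nat).
Implicit Types (f u : 'rV[R]_d -> R) (x v w : 'rV[R]_d).

Lemma dotvZl (c : R) v w : dotv (c *: v) w = c * dotv v w.
Proof. by rewrite /dotv mulr_sumr; apply: eq_bigr => i _; rewrite mxE mulrA. Qed.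

Lemma dotvZr (c : R) v w : dotv v (c *: w) = c * dotv v w.
Proof. by rewrite /dotv mulr_sumr; apply: eq_bigr => i _; rewrite mxE mulrCA. Qed.

Lemma dotv0r v : dotv v 0 = 0.
Proof. by rewrite -(scale0r (0 : 'rV[R]_d)) dotvZr mul0r. Qed.

Lemma dotv_ge0 v : 0 <= dotv v v.
Proof. by apply: sumr_ge0 => i _; rewrite -expr2 sqr_ge0. Qed.

Lemma continuous_dotv (F G : 'rV[R]_d -> 'rV[R]_d) :
  continuous F -> continuous G -> continuous (fun x => dotv (F x) (G x)).
Proof.
move=> cF cG; rewrite /dotv; apply: continuous_big => [|i _ x]; first exact: add_continuous.
have cc (H : 'rV[R]_d -> 'rV[R]_d) : continuous H -> continuous (fun y => H y 0 i).
  move=> cH y; apply: (@cvg_comp _ _ _ H (fun M : 'rV[R]_d => M 0 i)); first exact: cH.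
  exact: coord_continuous.
exact: (cvgM (cc _ cF x) (cc _ cG x)).
Qed.

(** A zero of a nonnegative function is a minimum: the difference quotients are nonnegative from the
    right and nonpositive from the left. *)
Lemma derive_min0 f x v : (forall y, 0 <= f y) -> f x = 0 ->
  derivable f x v -> 'D_v f x = 0.
Proof.
move=> f0 fx0 df; have := df; rewrite /derivable => dfx.
apply/eqP; rewrite eq_le; apply/andP; split.
  have /cvg_dnbhs_at_left H := dfx.
  apply: (cvgr_to_le H); near=> h.
  rewrite /= fx0 subr0 /GRing.scale/= nmulr_rle0//.
  by rewrite invr_lt0; near: h; exact: nbhs_left_lt.
have /cvg_dnbhs_at_right H := dfx.
apply: (cvgr_to_ge H); near=> h.
rewrite /= fx0 subr0 /GRing.scale/= pmulr_rge0//.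
by rewrite invr_gt0; near: h; exact: nbhs_right_gt.
Unshelve. all: by end_near. Qed.

(** Serves at the zeros of a density, where the logarithm and low powers escape the chain rule: the
    vanishing gradient makes dissipation and energy zero there. *)
Lemma grad_min0 f x : (forall y, 0 <= f y) -> f x = 0 ->
  differentiable f x -> grad f x = 0.
Proof.
move=> f0 fx0 df; apply/rowP => i; rewrite !mxE derive_min0//.
exact: diff_derivable.
Qed.

Lemma grad_comp (h : R -> R) (dh : R) f x : is_derive (f x) 1 h dh ->
  differentiable f x ->
  differentiable (h \o f) x /\ grad (h \o f) x = dh *: grad f x.
Proof.
move=> hd fd.
have hdiff : differentiable h (f x) by apply/derivable1_diffP; exact: ex_derive.
have hfd : differentiable (h \o f) x by exact: differentiable_comp.
split=> //; apply/rowP => i; rewrite !mxE !deriveE// diff_comp// diff1E//=.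
by rewrite derive1E (@derive_val _ _ _ _ _ _ _ hd) /GRing.scale/= mulrC.
Qed.

Lemma C1_comp (h dh : R -> R) f : C1 f ->
  (forall x, is_derive (f x) 1 h (dh (f x))) ->
  (forall x, {for f x, continuous dh}) ->
  C1 (h \o f) /\ forall x, grad (h \o f) x = dh (f x) *: grad f x.
Proof.
move=> fC1 hd hc; have [fd fc] := fC1.
have gE x : grad (h \o f) x = dh (f x) *: grad f x.
  by have [] := grad_comp (hd x) (fd x).
split=> //; split=> [x|x]; first by have [] := grad_comp (hd x) (fd x).
rewrite (_ : grad (h \o f) = fun y => (dh \o f) y *: grad f y); last exact/funext.
have hfc : {for x, continuous (dh \o f)}.
  by apply: continuous_comp; [exact: C1_continuous|exact: hc].
exact: (cvgZ hfc (fc x)).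
Qed.

(** The absolute value is there because [powR] is 1 at negative bases, which for [b > 0] would break
    continuity at 0. *)
Lemma continuous_normr_powR (b : R) : 0 <= b -> continuous (fun s : R => `|s| `^ b).
Proof.
rewrite le_eqVlt => /predU1P[<-|b0] s.
  by under eq_fun do rewrite powRr0; exact: cvg_cst.
have [->|s0] := eqVneq s 0.
  apply/cvgrPdist_lt => e e0; near=> t.
  rewrite normr0 powR0 ?gt_eqF// sub0r normrN ger0_norm ?powR_ge0//.
  have -> : e = (e `^ b^-1) `^ b by rewrite -powRrM mulVf ?gt_eqF// powRr1// ltW.
  apply: gt0_ltr_powR => //; rewrite ?nnegrE ?powR_ge0//.
  rewrite -[t]subr0 distrC; near: t; apply: cvgr_dist_lt => //.
  by rewrite powR_gt0.
have ns0 : 0 < `|s| by rewrite normr_gt0.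
apply: (continuous_cvg _ (is_derive1_continuous (is_derive1_powR b ns0))).
exact: norm_continuous.
Unshelve. all: by end_near. Qed.

(** The map t |t|^b is the odd extension of t^(b+1) to the line. Having a two-sided derivative at 0,
    it lets the chain rule pass through the zeros of a nonnegative function. *)
Lemma is_derive_mul_normr_powR (b s : R) : 0 <= b -> 0 <= s ->
  is_derive s 1 (fun t : R => t * `|t| `^ b) ((b + 1) * `|s| `^ b).
Proof.
move=> b0; rewrite le_eqVlt => /predU1P[<-|s0].
  (* At 0 the quotient is |h|^b, with limit 0^b; the factor [b + 1] does no harm, as it is 1 for
     [b = 0] and multiplies 0 otherwise. *)
  have H : h^-1 *: ((h *: (1 : R) + 0) * `|h *: (1 : R) + 0| `^ b - 0 * `|0 : R| `^ b)
      @[h --> (0 : R)^'] --> (b + 1) * `|0 : R| `^ b.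
    have -> : (b + 1) * `|0 : R| `^ b = `|0 : R| `^ b.
      have [->|bN0] := eqVneq b 0; first by rewrite add0r mul1r.
      by rewrite normr0 powR0// mulr0.
    have := (continuous_withinNx _ _).1 (@continuous_normr_powR _ b0 (0 : R)).
    apply: cvg_trans; apply: near_eq_cvg; near=> h.
    rewrite addr0 mul0r subr0 [_%:A]mulr1 /GRing.scale/= mulKf//.
    by near: h; exact: nbhs_dnbhs_neq.
  apply: DeriveDef; first by apply/cvg_ex; exists ((b + 1) * `|0 : R| `^ b).
  exact: cvg_lim.
have -> : (b + 1) * `|s| `^ b = s * (b * s `^ (b - 1)) + s `^ b * 1.
  have e : s * s `^ (b - 1) = s `^ b.
    by rewrite -{1}[s]powRr1 ?ltW// -powRD ?(gt_eqF s0) ?implybT// addrC subrK.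
  by rewrite gtr0_norm// mulrCA e; ring.
have dsb := is_derive1_powR b s0.
apply: near_eq_is_derive (is_deriveM (is_derive_id s 1) dsb).
near=> t; have t0 : 0 < t by near: t; exact: lt_nbhsr.
by rewrite /= gtr0_norm.
Unshelve. all: by end_near. Qed.

Lemma C1_powR_ge1 (a : R) u : 1 <= a -> C1 u -> (forall x, 0 <= u x) ->
  C1 (fun x => u x `^ a) /\
  forall x, grad (fun y => u y `^ a) x = (a * u x `^ (a - 1)) *: grad u x.
Proof.
move=> a1 uC1 u0; have b0 : 0 <= a - 1 by rewrite subr_ge0.
pose h := fun t : R => t * `|t| `^ (a - 1).
have hu : (fun x => u x `^ a) = h \o u.
  apply/funext => x; rewrite /h /= ger0_norm// mulr_powRB1//.
  exact: lt_le_trans a1.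
have dh x : is_derive (u x) 1 h (a * `|u x| `^ (a - 1)).
  by have := is_derive_mul_normr_powR b0 (u0 x); rewrite subrK.
have [] := @C1_comp h (fun s => a * `|s| `^ (a - 1)) _ uC1 dh.
  move=> x; apply: (@continuousM _ _ (cst a) _ (u x)); first exact: cst_continuous.
  exact: continuous_normr_powR.
by rewrite hu => ? gE; split=> // x; rewrite gE ger0_norm.
Qed.

Lemma grad_powR_gt0 (a : R) u x : differentiable u x -> 0 < u x ->
  grad (fun y => u y `^ a) x = (a * u x `^ (a - 1)) *: grad u x.
Proof. by move=> ud ux0; have [] := grad_comp (is_derive1_powR a ux0) ud. Qed.

Lemma C1_powR_gt0 (a : R) u : C1 u -> (forall x, 0 < u x) -> C1 (fun x => u x `^ a).
Proof.
move=> uC1 u0.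
have [] := @C1_comp (powR (R:=R) ^~ a) (fun s => a * s `^ (a - 1)) _ uC1 => // x.
  exact: is_derive1_powR.
apply: (@continuousM _ _ (cst a) _ (u x)); first exact: cst_continuous.
exact: (is_derive1_continuous (is_derive1_powR (a - 1) (u0 x))).
Qed.

Lemma C1_measurable_grad f : C1 f ->
  measurable_fun setT (fun x => dotv (grad f x) (grad f x)).
Proof. by case=> _ fc; apply: continuous_rV_measurable; exact: continuous_dotv. Qed.

End calculus.

(** * A bounded truncation with positive values *)

Section truncation.
Variables (R : realType) (d : nat).

(* A rewriting of [(s + e) / (1 + e * (s + e))]: on the half-line, a C1
   nonexpansive map, bounded and bounded away from [0], close to the identity. *)
Definition truncation (e s : R) : R := e^-1 * (1 - (1 + e * (s + e)) `^ (-1)).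


Section bounds.
Variable e : R.
Hypothesis e_gt0 : 0 < e.

Let den_gt1 (s : R) : 0 <= s -> 1 < 1 + e * (s + e).
Proof. by move=> s0; rewrite ltrDl mulr_gt0// ltr_wpDl. Qed.

Let den_gt0 (s : R) : 0 <= s -> 0 < 1 + e * (s + e).
Proof. by move=> s0; rewrite (lt_trans _ (den_gt1 s0)). Qed.

Lemma truncationE (s : R) : 0 <= s -> truncation e s = (s + e) / (1 + e * (s + e)).
Proof.
move=> s0; have := den_gt0 s0 => d0; rewrite /truncation powR_inv1 ?ltW//.
by field; rewrite !gt_eqF.
Qed.

Lemma is_derive_truncation (s : R) : 0 <= s ->
  is_derive s 1 (truncation e) ((1 + e * (s + e)) `^ (-1 - 1)).
Proof.
move=> s0; have d0 := den_gt0 s0.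
have dden : is_derive s 1 (fun t : R => 1 + e * (t + e)) e.
  rewrite -[X in is_derive _ _ _ X]add0r; apply: is_deriveD.
  rewrite -[X in is_derive _ _ _ X]mulr1; apply: is_deriveZ.
  by rewrite -[X in is_derive _ _ _ X]addr0; apply: is_deriveD.
have dV := @is_derive1_comp _ (powR (R:=R) ^~ (-1)) (fun t : R => 1 + e * (t + e))
  _ _ _ (is_derive1_powR (-1) d0) dden.
have dB := is_deriveZ e^-1 (is_deriveB (is_derive_cst (1 : R) s 1) dV).
apply: (is_derive_eq dB); rewrite /GRing.scale/=.
by field; rewrite gt_eqF.
Qed.

Lemma truncation_bounds (s : R) : 0 <= s ->
  truncation e 0 <= truncation e s <= Num.min e^-1 (s + e).
Proof.
move=> s0; have d0 := den_gt0 s0; have d1 := den_gt1 s0; have d00 := den_gt0 (lexx 0).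
apply/andP; split.
  rewrite /truncation ler_pM2l ?invr_gt0// lerD2l lerN2.
  by rewrite (powR_inv1 (ltW d0)) (powR_inv1 (ltW d00)) lef_pV2 ?posrE// lerD2l ler_pM2l// lerD2r.
rewrite le_min; apply/andP; split.
  rewrite /truncation ler_piMr ?invr_ge0 ?(ltW e_gt0)//.
  by rewrite lerBlDr lerDl powR_ge0.
rewrite truncationE// ler_pdivrMr// ler_peMr ?(ltW d1)//.
by rewrite addr_ge0// ltW.
Qed.

Lemma truncation0_gt0 : 0 < truncation e 0.
Proof. by rewrite truncationE// divr_gt0 ?den_gt0// add0r. Qed.

(** On the half-line the derivative (1 + e (s + e))^(-2) lies in (0, 1], so truncating does not
    raise the Dirichlet energy. *)
Lemma C1_truncation (f : 'rV[R]_d -> R) : C1 f -> (forall x, 0 <= f x) ->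
  C1 (fun x => truncation e (f x)) /\
  forall x, dotv (grad (fun y => truncation e (f y)) x) (grad (fun y => truncation e (f y)) x) <=
    dotv (grad f x) (grad f x).
Proof.
move=> fC1 f0.
have [x|TC1 TE] := @C1_comp _ _ (truncation e) (fun s => (1 + e * (s + e)) `^ (-1 - 1))
  f fC1 (fun x => is_derive_truncation (f0 x)).
  have d0 := den_gt0 (f0 x).
  apply: (@continuous_comp _ _ _ (fun s : R => 1 + e * (s + e)) (powR (R:=R) ^~ (-1 - 1))).
    apply: continuousD; first exact: cst_continuous.
    apply: (@continuousM _ _ (cst e)); first exact: cst_continuous.
    by apply: continuousD; [exact: id|exact: cst_continuous].
  exact: (is_derive1_continuous (is_derive1_powR _ d0)).
split=> // x; rewrite TE dotvZl dotvZr mulrA ler_piMl ?dotv_ge0//.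
rewrite mulr_ile1 ?powR_ge0// -[leRHS](powRr0 (1 + e * (f x + e))).
  by apply: ler_powR; [exact: ltW (den_gt1 (f0 x))|lra].
by apply: ler_powR; [exact: ltW (den_gt1 (f0 x))|lra].
Qed.

End bounds.

Lemma cvg_truncation (s : R) : 0 <= s -> truncation n.+1%:R^-1 s @[n --> \oo] --> s.
Proof.
move=> s0.
have cw : s + n.+1%:R^-1 @[n --> \oo] --> s.
  by rewrite -[X in _ --> X]addr0; apply: cvgD; [exact: cvg_cst|exact: cvg_harmonic].
have H : (s + n.+1%:R^-1) / (1 + n.+1%:R^-1 * (s + n.+1%:R^-1)) @[n --> \oo] --> s / (1 + 0 * s).
  apply: cvgM => //; apply: cvgV; first by rewrite mul0r addr0.
  apply: cvgD; [exact: cvg_cst|apply: cvgM => //; exact: cvg_harmonic].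
rewrite mul0r addr0 divr1 in H; apply: cvg_trans H; apply: near_eq_cvg.
by near=> n; rewrite truncationE// invr_gt0.
Unshelve. all: by end_near. Qed.

End truncation.

(** * Lower semicontinuity of the Jensen gap *)

Section fatou_bound.
Context (dT : measure_display) (T : measurableType dT) (R : realType).
Variable mu : {measure set T -> \bar R}.

Lemma fatou_le (f_ : nat -> T -> R) (f : T -> R) (K : R) :
  (forall n, measurable_fun setT (f_ n)) ->
  (forall n x, 0 <= f_ n x) ->
  (forall x, f_ n x @[n --> \oo] --> f x) ->
  (forall n, (\int[mu]_x (f_ n x)%:E <= K%:E)%E) ->
  (\int[mu]_x (f x)%:E <= K%:E)%E.
Proof.
move=> mf f0 fcvg fK.
have -> : (\int[mu]_x (f x)%:E = \int[mu]_x limn_einf (fun n => (f_ n x)%:E))%E.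
  apply: eq_integral => x _; apply/esym; apply: (cvg_limn_einf_sup _).1.
  by apply: cvg_EFin; [near=> n|exact: fcvg].
apply: (le_trans (fatou _ _ _ _)) => //[n|n x _|].
- exact/measurable_EFinP.
- by rewrite lee_fin.
- rewrite limn_einf_lim; apply: lime_le; first exact: is_cvg_einfs.
  near=> n; apply: le_trans (fK n).
  by apply: ereal_inf_lbound; exists n => //=.
Unshelve. all: by end_near. Qed.

End fatou_bound.

Section convex_gap.
Context (dT : measure_display) (T : measurableType dT) (R : realType).
Variable mu : {measure set T -> \bar R}.
Hypothesis mu1 : mu setT = 1%E.
Implicit Types (g : T -> R) (phi dphi : R -> R).

Lemma integrable_cst (k : R) : mu.-integrable setT (EFin \o cst k).
Proof.
apply/integrableP; split; first exact/measurable_EFinP.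
by rewrite /= integral_cst// mu1 mule1 ltry.
Qed.

Lemma Rintegral_cst1 (k : R) : \int[mu]_x k = k.
Proof. by rewrite Rintegral_cst// mu1 mulr1. Qed.

Lemma EFin_Rintegral g : mu.-integrable setT (EFin \o g) ->
  (\int[mu]_x (g x)%:E)%E = (\int[mu]_x g x)%:E.
Proof. by move=> ig; rewrite /Rintegral fineK//; exact: integrable_fin_num. Qed.

Lemma integrable_bounded g (B : R) : measurable_fun setT g ->
  (forall x, `|g x| <= B) -> mu.-integrable setT (EFin \o g).
Proof.
move=> mg gB; apply: le_integrable (integrable_cst B) => //.
  exact/measurable_EFinP.
by move=> x _ /=; rewrite lee_fin (le_trans (gB x))// ler_norm.
Qed.

Lemma integrable_continuous_bounded phi g (K : R) : continuous phi ->
  measurable_fun setT g -> (forall x, 0 <= g x <= K) ->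
  mu.-integrable setT (EFin \o (phi \o g)).
Proof.
move=> cphi mg gK; have [K0|K0] := leP 0 K; last first.
  have gE (x : T) : False by have /andP[/le_trans/[apply]] := gK x; rewrite leNgt K0.
  rewrite (_ : EFin \o _ = EFin \o cst 0); first exact: integrable_cst.
  by apply/funext => x; case: (gE x).
have [|c _ phic] := @EVT_max R (fun s => `|phi s|) 0 K K0.
  apply: continuous_subspaceT => s.
  by apply: (@continuous_comp _ _ _ phi); [exact: cphi|exact: norm_continuous].
apply: (@integrable_bounded _ `|phi c|).
  by apply: measurableT_comp => //; exact: continuous_measurable_fun.
by move=> x; apply: phic; rewrite in_itv/= gK.
Qed.

Definition gap phi g : R := \int[mu]_x phi (g x) - phi (\int[mu]_x g x).

Definition bregman phi dphi (s M : R) : R := phi s - phi M - dphi M * (s - M).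

Lemma integrable_bregman phi dphi g M :
  mu.-integrable setT (EFin \o g) -> mu.-integrable setT (EFin \o (phi \o g)) ->
  mu.-integrable setT (EFin \o (fun x => bregman phi dphi (g x) M)).
Proof.
move=> ig ip.
have -> : EFin \o (fun x => bregman phi dphi (g x) M) =
  ((EFin \o (phi \o g)) \- (EFin \o cst (phi M)) \-
  (fun x => (dphi M)%:E * ((EFin \o g) \- (EFin \o cst M)) x))%E.
  by apply/funext => x.
apply: integrableB => //; first exact: integrableB (integrable_cst _).
by apply: integrableZl => //; apply: integrableB (integrable_cst _).
Qed.

(** Around the mean, the linear term of the divergence integrates to 0. The gap, a difference,
    thereby becomes a single integral to which positivity and Fatou's lemma apply. *)
Lemma gapE phi dphi g :
  mu.-integrable setT (EFin \o g) -> mu.-integrable setT (EFin \o (phi \o g)) ->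
  gap phi g = \int[mu]_x bregman phi dphi (g x) (\int[mu]_x g x).
Proof.
move=> ig ip; set M := Rintegral mu setT g.
have ig0 := integrableB measurableT ig (integrable_cst M).
have ip0 := integrableB measurableT ip (integrable_cst (phi M)).
rewrite /bregman RintegralB//; last exact: (integrableZl measurableT (dphi M) ig0).
rewrite RintegralB//; last exact: integrable_cst.
rewrite RintegralZl// RintegralB//; last exact: integrable_cst.
by rewrite !Rintegral_cst1 subrr mulr0 subr0.
Qed.

(** The sets where [g] is at most n + 1 exhaust a space of mass 1, so they cannot all be
    negligible. *)
Lemma exists_sublevel g : measurable_fun setT g ->
  exists A : R, 0 < A /\ (0 < mu [set x | (g x <= A)%R])%E.
Proof.
move=> mg; have ms (A : R) : measurable [set x | g x <= A].
  by rewrite -[X in measurable X]setTI; exact: measurable_fun_le.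
apply: contrapT => /forallNP H.
have : mu.-negligible (\bigcup_n [set x | g x <= n.+1%:R]).
  apply: negligible_bigcup => n; apply/negligibleP => //.
  have := H n.+1%:R; rewrite ltr0Sn => /not_andP[//|].
  by move=> /negP; rewrite -leNgt => h; apply/eqP; rewrite eq_le h measure_ge0.
rewrite (_ : \bigcup_n _ = setT).
  by move=> /(measure_negligible measurableT) /(etrans (esym mu1)) /eqP; rewrite onee_eq0.
apply/seteqP; split => // x _; exists (Num.bound `|g x|) => //=.
rewrite (le_trans (ler_norm _))// ltW//.
by rewrite (lt_le_trans (archi_boundP (normr_ge0 _)))// ler_nat leqnSn.
Qed.


(* When the means of [g_ n] go to infinity, the Bregman divergences to them blow
   up on a sublevel set of the limit: a bounded gap keeps the means bounded,
   hence the limit integrable, and Fatou's lemma applies to the divergences. *)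
Lemma gap_lsc phi dphi (g_ : nat -> T -> R) g (c K : R) :
  (forall s M : R, 0 <= s -> 0 < M -> 0 <= bregman phi dphi s M) ->
  (forall A L : R, exists B : R, forall s M : R,
     0 <= s <= A -> B < M -> L < bregman phi dphi s M) ->
  continuous phi -> (forall M : R, 0 < M -> {for M, continuous dphi}) ->
  (forall n, mu.-integrable setT (EFin \o g_ n)) ->
  (forall n, mu.-integrable setT (EFin \o (phi \o g_ n))) ->
  measurable_fun setT g ->
  (forall n x, 0 <= g_ n x <= c * (g x + 1)) -> (forall x, 0 <= g x) ->
  (forall x, g_ n x @[n --> \oo] --> g x) ->
  (forall n, 0 < \int[mu]_x g_ n x) ->
  (forall n, gap phi (g_ n) <= K) ->
  mu.-integrable setT (EFin \o g) /\
  (0 < \int[mu]_x g x ->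
    mu.-integrable setT (EFin \o (phi \o g)) /\ gap phi g <= K).
Proof.
move=> D0 Dinf cphi cdphi ig ip mg gb g0 gcvg M0 gapK.
pose M n := \int[mu]_x g_ n x.
have iD n N := integrable_bregman dphi N (ig n) (ip n).
have mphi : measurable_fun setT phi by exact: continuous_measurable_fun.
have mD n : measurable_fun setT (fun x => bregman phi dphi (g_ n x) (M n)).
  by apply/measurable_EFinP; exact: (measurable_int mu (iD n (M n))).
have intD n : (\int[mu]_x (bregman phi dphi (g_ n x) (M n))%:E <= K%:E)%E.
  by rewrite EFin_Rintegral ?iD// lee_fin -gapE.
have gn0 n x : 0 <= g_ n x by have /andP[] := gb n x.
have c0 : 0 <= c.
  have [x _] : exists x : T, True.
    apply: contrapT => /forallNP nT; move: mu1.
    rewrite (_ : setT = set0) ?measure0; last by apply/seteqP; split => // x; have := nT x.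
    by move/eqP; rewrite eq_sym onee_eq0.
  have /andP[a b] := gb 0%N x; have := le_trans a b.
  by rewrite pmulr_lge0// ltr_wpDl.
have [A [A0 pA]] := exists_sublevel mg.
have mA : measurable [set x | (g x <= A)%R].
  by rewrite -[X in measurable X]setTI; exact: measurable_fun_le.
have pA1 : (mu [set x | (g x <= A)%R] <= 1)%E by rewrite -mu1 le_measure ?inE.
pose p := fine (mu [set x | (g x <= A)%R]).
have pE : mu [set x | (g x <= A)%R] = p%:E.
  by rewrite fineK// ge0_fin_numE// (le_lt_trans pA1)// ltry.
have p0 : 0 < p by rewrite -lte_fin -pE.
have [B MB] : exists B : R, forall n, M n <= B.
  (* On the sublevel set all [g_ n] are at most c (A + 1). The level |K| / p + 1, multiplied by the
     mass [p] of this set, exceeds [K], which a mean beyond [B] would contradict. *)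
  have [B HB] := Dinf (c * (A + 1)) (`|K| / p + 1).
  exists B => n; rewrite leNgt; apply/negP => BM.
  have : (((`|K| / p + 1) * p)%:E <= K%:E)%E.
    apply: le_trans (intD n); rewrite EFinM -pE -integral_cst//.
    apply: (@le_trans _ _ (\int[mu]_(x in [set x | (g x <= A)%R])
        (bregman phi dphi (g_ n x) (M n))%:E)%E).
      apply: ge0_le_integral => //.
      - by move=> x _ /=; rewrite lee_fin addr_ge0 ?divr_ge0// ltW.
      - by apply/measurable_EFinP; exact: measurable_funTS.
      - move=> x /= gxA; rewrite lee_fin ltW// HB//.
        have /andP[-> /le_trans -> //] := gb n x.
        by rewrite ler_wpM2l// lerD2r.
    apply: ge0_subset_integral => //; first exact/measurable_EFinP.
    by move=> x _; rewrite lee_fin D0//; exact: M0.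
  rewrite lee_fin mulrDl divfK ?gt_eqF// mul1r leNgt => /negP; apply.
  by rewrite (le_lt_trans (ler_norm _))// ltrDl.
have igg : mu.-integrable setT (EFin \o g).
  apply/integrableP; split; first exact/measurable_EFinP.
  apply: (@le_lt_trans _ _ B%:E); last exact: ltry.
  rewrite (_ : (fun _ => _) = fun x => (g x)%:E); last first.
    by apply/funext => x /=; rewrite ger0_norm.
  apply: (fatou_le (f_ := g_)) => //.
    by move=> n; apply/measurable_EFinP; exact: (measurable_int mu (ig n)).
  by move=> n; rewrite EFin_Rintegral// lee_fin; exact: MB.
(* The function c (g + 1), integrable by now, dominates and makes the means converge; at a positive
   limit [N] the map [dphi] is continuous, so the divergences converge pointwise. *)
split=> // Mg0; set N := \int[mu]_x g x in Mg0.
have Mcvg : M n @[n --> \oo] --> N.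
  have idom : mu.-integrable setT (fun x => c%:E * ((EFin \o g) \+ (EFin \o cst 1%R)) x)%E.
    by apply: integrableZl => //; apply: integrableD => //; exact: integrable_cst.
  have [||||_ _ H] := dominated_convergence measurableT (f_ := fun n => EFin \o g_ n)
    (f := EFin \o g) _ _ _ idom.
  - by move=> n; exact: (measurable_int mu (ig n)).
  - exact/measurable_EFinP.
  - by apply: aeW => x _; apply: cvg_EFin; [near=> n|exact: gcvg].
  - by apply: aeW => x n _; rewrite /= lee_fin ger0_norm//; have /andP[] := gb n x.
  by apply: fine_cvg; rewrite -EFin_Rintegral.
have Dcvg x : bregman phi dphi (g_ n x) (M n) @[n --> \oo] --> bregman phi dphi (g x) N.
  apply: cvgB; [apply: cvgB|apply: cvgM].
  - exact: (continuous_cvg _ (cphi _) (gcvg x)).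
  - exact: (continuous_cvg _ (cphi _) Mcvg).
  - exact: (continuous_cvg _ (cdphi _ Mg0) Mcvg).
  - exact: cvgB (gcvg x) Mcvg.
have DK : (\int[mu]_x (bregman phi dphi (g x) N)%:E <= K%:E)%E.
  by apply: (fatou_le (f_ := fun n x => bregman phi dphi (g_ n x) (M n))) => // n x;
    apply: D0; [exact: gn0|exact: M0].
have mDg : measurable_fun setT (fun x => bregman phi dphi (g x) N).
  apply: measurable_funB; first by apply: measurable_funB => //; exact: measurableT_comp.
  by apply: measurable_funM => //; exact: measurable_funB.
have iDg : mu.-integrable setT (EFin \o (fun x => bregman phi dphi (g x) N)).
  apply/integrableP; split; first exact/measurable_EFinP.
  rewrite (_ : (fun _ => _) = fun x => (bregman phi dphi (g x) N)%:E); last first.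
    by apply/funext => x /=; rewrite ger0_norm ?D0.
  by rewrite (le_lt_trans DK)// ltry.
(* Solving the definition of the divergence for phi(g) writes it as a sum of integrable
   functions. *)
have ipg : mu.-integrable setT (EFin \o (phi \o g)).
  rewrite (_ : EFin \o _ = (EFin \o (fun x => bregman phi dphi (g x) N)) \+
    ((EFin \o cst (phi N)) \+ (fun x => (dphi N)%:E * ((EFin \o g) \- (EFin \o cst N)) x)))%E.
    apply: integrableD => //; apply: integrableD => //; first exact: integrable_cst.
    by apply: integrableZl => //; apply: integrableB => //; exact: integrable_cst.
  by apply/funext => x /=; rewrite -!(EFinB, EFinM, EFinD) /bregman; congr EFin; ring.
split=> //; rewrite (gapE dphi)// -lee_fin -EFin_Rintegral//.
Unshelve. all: by end_near. Qed.

End convex_gap.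

(** * The convex functions s^2 and s ln s *)

Section entropies.
Variable R : realType.
Implicit Types s M : R.

Definition sqr_fun s : R := s ^+ 2.
Definition xlnx s : R := s * ln s.

Lemma bregman_sqr s M : bregman sqr_fun (fun t => 2 * t) s M = (s - M) ^+ 2.
Proof. by rewrite /bregman /sqr_fun; ring. Qed.

Lemma bregman_sqr_unbounded (A L : R) : exists B : R, forall s M,
  0 <= s <= A -> B < M -> L < bregman sqr_fun (fun t => 2 * t) s M.
Proof.
exists (A + (`|L| + 1)) => s M /andP[s0 sA] BM; rewrite bregman_sqr.
have := ler_norm L; have := normr_ge0 L; nra.
Qed.

Lemma le_subV_ln s : 0 < s -> 1 - s^-1 <= ln s.
Proof.
move=> s0; have s'0 : 0 < s^-1 by rewrite invr_gt0.
have := @le_ln1Dx R (s^-1 - 1).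
have -> : 1 + (s^-1 - 1) = s^-1 by ring.
by rewrite lnV ?posrE//; lra.
Qed.

(** With s = a^2 and M = b^2 the divergence is 2 a^2 ln(a/b) - a^2 + b^2, and ln x >= 1 - 1/x at x =
    a/b bounds it below by (a - b)^2. Both nonnegativity and blow-up for large [M] follow. *)
Lemma bregman_xlnx_ge s M : 0 <= s -> 0 < M ->
  (Num.sqrt s - Num.sqrt M) ^+ 2 <= bregman xlnx (fun t => ln t + 1) s M.
Proof.
move=> s0 M0; rewrite /bregman /xlnx.
have b0 : 0 < Num.sqrt M by rewrite sqrtr_gt0.
have bM : Num.sqrt M ^+ 2 = M by rewrite sqr_sqrtr// ltW.
have sM : s * ln s - M * ln M - (ln M + 1) * (s - M) = s * (ln s - ln M) - s + M by ring.
rewrite {}sM; move: s0; rewrite le_eqVlt => /predU1P[<-|s0].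
  by rewrite sqrtr0 sub0r sqrrN bM mul0r subr0 add0r.
have a0 : 0 < Num.sqrt s by rewrite sqrtr_gt0.
have as_ : Num.sqrt s ^+ 2 = s by rewrite sqr_sqrtr// ltW.
rewrite -{2 3 4}as_ -{2 3}bM; set a := Num.sqrt s in a0 *; set b := Num.sqrt M in b0 *.
rewrite !lnXn// -mulrnBl -ln_div ?posrE//.
have := le_subV_ln (divr_gt0 a0 b0); rewrite invf_div => /(ler_wpM2l (sqr_ge0 a)).
have -> : a ^+ 2 * (1 - b / a) = a ^+ 2 - a * b by field; rewrite gt_eqF.
by move=> h; rewrite -mulr_natr; lra.
Qed.

Lemma bregman_xlnx_unbounded (A L : R) : exists B : R, forall s M,
  0 <= s <= A -> B < M -> L < bregman xlnx (fun t => ln t + 1) s M.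
Proof.
(* For [M] beyond r^2 the square roots of [s] and [M] differ by more than |L| + 1, whose square
   exceeds [L]. *)
pose r := Num.sqrt A + (`|L| + 1).
have r0 : 0 < r by rewrite ltr_wpDl// ?sqrtr_ge0// ltr_wpDl.
exists (r ^+ 2) => s M /andP[s0 sA] BM.
have M0 : 0 < M by rewrite (le_lt_trans _ BM)// sqr_ge0.
apply: lt_le_trans (bregman_xlnx_ge s0 M0).
have rM : r < Num.sqrt M.
  by rewrite -(@ger0_norm _ r) ?ltW// -sqrtr_sqr ltr_sqrt.
have sA' : Num.sqrt s <= Num.sqrt A by rewrite ler_wsqrtr.
move: rM; rewrite /r; have := ler_norm L; have := normr_ge0 L; nra.
Qed.

(** As [ln] is 0 on the negative axis, so is [xlnx], and only the point 0 is delicate. There it is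
    squeezed between 2 t - 2 sqrt t and t (t - 1): the lower bound is ln x >= 1 - 1/x at x = sqrt t,
    the upper one ln t <= t - 1. *)
Lemma continuous_xlnx : continuous xlnx.
Proof.
move=> s; have [s0|s0|->] := ltgtP s 0.
- rewrite /continuous_at {2}/xlnx ln0 ?ltW// mulr0.
  apply: cvg_near_cst; near=> t; rewrite /xlnx ln0 ?mulr0//.
  by apply/ltW; near: t; exact: lt_nbhsl.
- exact: (cvgM cvg_id (is_derive1_continuous (is_derive1_ln s0))).
- rewrite /continuous_at {2}/xlnx mul0r.
  apply: (@squeeze_cvgr _ _ _ _ (fun t => 2 * t - 2 * Num.sqrt t) (fun t => t * (t - 1))).
  + near=> t; have [t0|t0] := leP t 0.
      rewrite /xlnx ln0// ler0_sqrtr//; apply/andP; split; nra.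
    have a0 : 0 < Num.sqrt t by rewrite sqrtr_gt0.
    rewrite /xlnx; apply/andP; split; last first.
      rewrite ler_wpM2l ?(ltW t0)//; have := @le_ln1Dx R (t - 1).
      by rewrite (_ : 1 + (t - 1) = t); [apply; lra|ring].
    have := le_subV_ln a0 => /(ler_wpM2l (ltW t0)).
    have tE : t = Num.sqrt t ^+ 2 by rewrite sqr_sqrtr// ltW.
    have -> : ln t = 2 * ln (Num.sqrt t) by rewrite {1}tE lnXn// mulr_natl.
    have -> : t * (1 - (Num.sqrt t)^-1) = t - Num.sqrt t.
      by move: tE a0; move: (Num.sqrt t) => a -> a0; field; rewrite gt_eqF.
    lra.
  + have c : {for (0 : R), continuous (fun t : R => 2 * t - 2 * Num.sqrt t)}.
      apply: continuousB; apply: continuousM.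
      - exact: cst_continuous.
      - by move=> ?; exact: id.
      - exact: cst_continuous.
      - exact: sqrt_continuous.
    have : 2 * t - 2 * Num.sqrt t @[t --> (0 : R)] --> (2 * 0 - 2 * Num.sqrt 0 : R) := c.
    by rewrite sqrtr0 !mulr0 subr0.
  + have c : {for (0 : R), continuous (fun t : R => t * (t - 1))}.
      apply: continuousM; first by move=> ?; exact: id.
      by apply: continuousB; [move=> ?; exact: id|exact: cst_continuous].
    have : t * (t - 1) @[t --> (0 : R)] --> (0 * (0 - 1) : R) := c.
    by rewrite mul0r.
Unshelve. all: by end_near. Qed.

End entropies.

(** * Variance and entropy as gaps *)

Section var_ent.
Context (dT : measure_display) (T : measurableType dT) (R : realType).
Variable mu : {measure set T -> \bar R}.
Hypothesis mu1 : mu setT = 1%E.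
Implicit Types (g : T -> R).

Lemma Var_gap g : mu.-integrable setT (EFin \o g) ->
  mu.-integrable setT (EFin \o (@sqr_fun R \o g)) ->
  Var mu g = (gap mu (@sqr_fun R) g)%:E.
Proof.
move=> ig ig2; rewrite /Var (EFin_Rintegral ig) (EFin_Rintegral ig2)//.
Qed.

(** A nonnegative function of mean 0 vanishes almost everywhere. This covers the case that the
    divergence estimates, stated for [0 < M], leave out. *)
Lemma mean0_comp (phi : R -> R) g : (forall x, 0 <= g x) ->
  mu.-integrable setT (EFin \o g) -> \int[mu]_x g x = 0 ->
  measurable_fun setT phi -> phi 0 = 0 ->
  mu.-integrable setT (EFin \o (phi \o g)) /\ \int[mu]_x phi (g x) = 0.
Proof.
move=> g0 ig M0 mphi phi0.
have mg : measurable_fun setT g by apply/measurable_EFinP; exact: (measurable_int mu ig).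
have mpg : measurable_fun setT (EFin \o (phi \o g)).
  by apply/measurable_EFinP; exact: measurableT_comp.
have ae0 : ae_eq mu setT (EFin \o g) (cst 0%E).
  apply/(ae_eq_integral_abs _ measurableT); first exact/measurable_EFinP.
  under eq_integral do rewrite /= ger0_norm//.
  by rewrite EFin_Rintegral// M0.
have aep : ae_eq mu setT (EFin \o (phi \o g)) (cst 0%E).
  by apply: filterS ae0 => x /= /(_ I) [->] _; rewrite phi0.
have int0 : (\int[mu]_x `|(phi (g x))%:E| = 0)%E.
  by apply/(ae_eq_integral_abs _ measurableT mpg).
split; first by apply/integrableP; split => //; rewrite int0 ltry.
rewrite /Rintegral.
rewrite (_ : integral _ _ _ = 0%E)//.
by transitivity (\int[mu]_x (cst 0 x : \bar R))%E; [exact: ae_eq_integral|exact: integral0].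
Qed.

Lemma Ent_gap g : (forall x, 0 <= g x) -> mu.-integrable setT (EFin \o g) ->
  mu.-integrable setT (EFin \o (@xlnx R \o g)) ->
  Ent mu g = (gap mu (@xlnx R) g)%:E.
Proof.
move=> g0 ig ip; rewrite /Ent (EFin_Rintegral ig) /=; set M := Rintegral mu setT g.
have : 0 <= M by exact: Rintegral_ge0.
(* If [M] is 0, then [g x / M] and its logarithm are 0 by convention, while the gap is 0 because [g]
   vanishes almost everywhere. *)
rewrite le_eqVlt => /predU1P[M0|M0].
  have mx : measurable_fun setT (@xlnx R).
    by apply: continuous_measurable_fun; exact: continuous_xlnx.
  have x0 : xlnx (0 : R) = 0 by rewrite /xlnx mul0r.
  have [_] := mean0_comp g0 ig (esym M0) mx x0.
  rewrite /gap -/M -M0 x0 => ->; rewrite subr0.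
  under eq_integral do rewrite invr0 mulr0 ln0// mulr0.
  exact: integral0.
have -> : (fun x => (g x * ln (g x / M))%:E) = EFin \o (fun x => xlnx (g x) - ln M * g x).
  apply/funext => x; congr EFin; rewrite /xlnx.
  have := g0 x; rewrite le_eqVlt => /predU1P[<-|gx]; first by rewrite !(mul0r,mulr0) subr0.
  by rewrite ln_div ?posrE//; ring.
rewrite EFin_Rintegral.
  rewrite RintegralB// ?RintegralZl// -/M; last exact: (integrableZl measurableT (ln M) ig).
  by rewrite /gap -/M /xlnx [ln M * M]mulrC.
exact: (integrableB measurableT ip (integrableZl measurableT (ln M) ig)).
Qed.

Lemma Lfun_bounded g (B r : R) : 1 <= r -> measurable_fun setT g ->
  (forall x, `|g x| <= B) -> g \in Lfun mu r%:E.
Proof.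
move=> r1 mg gB; rewrite inE; apply/andP; split; rewrite inE//=.
have r0 : r != 0 by rewrite gt_eqF// (lt_le_trans _ r1).
rewrite /finite_norm; apply: (lty_poweRy r0); rewrite poweR_Lnorm//.
have mp : measurable_fun setT (fun x => `|g x| `^ r).
  by apply: (@measurableT_comp _ _ _ _ _ _ (@powR R ^~ r)) => //; exact: measurableT_comp.
have /integrableP[_] : mu.-integrable setT (EFin \o (fun x => `|g x| `^ r)).
  apply: (integrable_bounded mu1 (B := B `^ r)) => // x.
  by rewrite ger0_norm ?powR_ge0// ge0_ler_powR ?nnegrE// ?(le_trans _ r1)// (le_trans _ (gB x)).
apply: le_lt_trans; rewrite le_eqVlt; apply/orP; left; apply/eqP.
by apply: eq_integral => x _ /=; rewrite (ger0_norm (powR_ge0 _ _)).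
Qed.

End var_ent.

(** * The Gibbs measure is a probability *)

Section gibbs_probability.
Variables (R : realType) (d : nat) (psi : 'rV[R]_d -> R) (psiC2 : C2 psi).
Hypothesis Z_fin : (partition_function psi < +oo)%E.

(** The unit cube has measure 1, also in dimension 0, where the product of side lengths is empty. *)
Lemma lebesgue_rV_gt0 : (0 < lebesgue_rV R d setT)%E.
Proof.
apply: (@lt_le_trans _ _ 1%E) => //.
pose B := [set x : 'rV[R]_d | forall i,
  (const_mx 0 : 'rV[R]_d) 0 i <= x 0 i <= (const_mx 1 : 'rV[R]_d) 0 i].
have mB : measurable B.
  rewrite (_ : B = \bigcap_(i in [set: 'I_d]) ((fun x : 'rV[R]_d => x 0 i) @^-1` `[0, 1])).
    apply: fin_bigcap_measurable => // i _; rewrite -[X in measurable X]setTI.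
    by apply: (continuous_rV_measurable (@coord_continuous _ _ _ 0 i)).
  apply/seteqP; split => [x h i _|x h i].
    by have := h i; rewrite /= in_itv !mxE.
  by have := h i I; rewrite /= in_itv !mxE.
rewrite -[1%E](_ : lebesgue_rV R d B = 1%E); first by apply: le_measure; rewrite ?inE.
rewrite /B lebesgue_rV_box; last by move=> i; rewrite !mxE.
by rewrite big1// => i _; rewrite !mxE subr0.
Qed.

Let mdens : measurable_fun setT (fun x => expR (- psi x)).
Proof.
by apply: measurableT_comp => //; apply: measurableT_comp => //; exact: C2_measurable.
Qed.

(** A positive density with integral 0 would make the whole space negligible. Positivity rules out
    that the normalising factor is the inverse of 0, read as 0. *)
Lemma partition_function_gt0 : (0 < partition_function psi)%E.
Proof.
rewrite lt_neqAle integral_ge0 ?andbT; last by move=> x _; rewrite lee_fin expR_ge0.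
apply/eqP => Z0.
have ae0 : ae_eq (lebesgue_rV R d) setT (EFin \o (fun x => expR (- psi x))) (cst 0%E).
  apply/(ae_eq_integral_abs _ measurableT); first exact/measurable_EFinP.
  under eq_integral do rewrite /= ger0_norm ?expR_ge0//.
  exact/esym.
have : (lebesgue_rV R d).-negligible setT.
  by apply: negligibleS ae0 => x _ /(_ I)/= [] /eqP; rewrite gt_eqF// expR_gt0.
move=> /(measure_negligible measurableT) L0.
by have := lebesgue_rV_gt0; rewrite L0 ltxx.
Qed.

Lemma gibbs_setT : gibbs psiC2 setT = 1%E.
Proof.
have Z0 := partition_function_gt0.
have ZE : partition_function psi = (fine (partition_function psi))%:E.
  by rewrite fineK// ge0_fin_numE// ltW.
have z0 : 0 < fine (partition_function psi) by rewrite -lte_fin -ZE.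
rewrite /gibbs; under eq_integral do rewrite EFinM.
rewrite ge0_integralZl//.
- by rewrite -/(partition_function psi) {2}ZE -EFinM mulVf// gt_eqF.
- exact/measurable_EFinP.
- by rewrite lee_fin invr_ge0 ltW.

Qed.

End gibbs_probability.

(** * Decay and functional inequality for a general convex function *)

Section decay_equivalence.
Variables (R : realType) (d : nat) (psi : 'rV[R]_d -> R) (psiC2 : C2 psi).
Hypothesis Z_fin : (partition_function psi < +oo)%E.
Variables (m : R) (m_ge1 : 1 <= m).
Let mu : {measure set 'rV[R]_d -> \bar R} := gibbs psiC2.
Let mu1 : mu setT = 1%E := gibbs_setT psiC2 Z_fin.

Variables (phi dphi d2phi : R -> R) (F : ('rV[R]_d -> R) -> \bar R).
Variables (p r a kappa : R).
Hypothesis F_gap : forall g : 'rV[R]_d -> R, (forall x, 0 <= g x) ->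
  mu.-integrable setT (EFin \o g) -> mu.-integrable setT (EFin \o (phi \o g)) ->
  F g = (gap mu phi g)%:E.
Hypothesis phi0 : phi 0 = 0.
Hypothesis cphi : continuous phi.
Hypothesis dphi_derive : forall s : R, 0 < s -> is_derive s 1 dphi (d2phi s).
Hypothesis bregman_ge0 :
  forall s M : R, 0 <= s -> 0 < M -> 0 <= bregman phi dphi s M.
Hypothesis bregman_unbounded : forall A L : R, exists B : R, forall s M : R,
  0 <= s <= A -> B < M -> L < bregman phi dphi s M.
Hypotheses (p_gt0 : 0 < p) (kappa_gt0 : 0 < kappa) (a_ge0 : 0 <= a).
Hypothesis rE : r = 1 + a.
(* [u |-> u `^ p^-1] turns the dissipation of [int phi u] along the flow into a
   multiple of the Dirichlet energy. *)
Hypothesis dissipation : forall s : R, 0 < s ->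
  d2phi s * (m * s `^ (m - 1)) = kappa * (p^-1 * s `^ (p^-1 - 1)) ^+ 2.

Let cdphi (M : R) : 0 < M -> {for M, continuous dphi}.
Proof. by move=> M0; exact: (is_derive1_continuous (dphi_derive M0)). Qed.

Let r_gt0 : 0 < r. Proof. by rewrite rE ltr_pwDl. Qed.

Definition energy (f : 'rV[R]_d -> R) x := dotv (grad f x) (grad f x).

Definition dissip (u : 'rV[R]_d -> R) x :=
  dotv (grad (dphi \o u) x) (grad (powm m u) x).

Lemma gap_ge0 (g : 'rV[R]_d -> R) : (forall x, 0 <= g x) -> mu.-integrable setT (EFin \o g) ->
  mu.-integrable setT (EFin \o (phi \o g)) -> 0 <= gap mu phi g.
Proof.
move=> g0 ig ip; have : 0 <= \int[mu]_x g x by exact: Rintegral_ge0.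
rewrite le_eqVlt => /predU1P[M0|M0].
  have [_] := mean0_comp g0 ig (esym M0) (continuous_measurable_fun cphi) phi0.
  by rewrite /gap -M0 phi0 => ->; rewrite subr0.
by rewrite (gapE mu1 dphi)//; apply: Rintegral_ge0 => x _; exact: bregman_ge0.
Qed.

Lemma dissip_gt0 (u : 'rV[R]_d -> R) x : differentiable u x -> 0 < u x ->
  dissip u x = kappa * (p^-1 * u x `^ (p^-1 - 1)) ^+ 2 * dotv (grad u x) (grad u x).
Proof.
move=> ud ux; rewrite /dissip.
have [_ ->] := grad_comp (dphi_derive ux) ud.
by rewrite (grad_powR_gt0 m ud ux) dotvZl dotvZr mulrA dissipation.
Qed.

Lemma dissip_eq0 (u : 'rV[R]_d -> R) x : C1 u -> (forall y, 0 <= u y) -> u x = 0 -> dissip u x = 0.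
Proof.
move=> uC1 u0 ux; have [_ gE] := C1_powR_ge1 m_ge1 uC1 u0.
by rewrite /dissip /powm gE (grad_min0 u0 ux (proj1 uC1 x)) scaler0 dotv0r.
Qed.

Lemma decay_of_dissipation C u0 u : 0 < C -> pme_solution psiC2 m u0 u ->
  differentiable_functional psiC2 m phi dphi u ->
  (forall t : R, 0 < t ->
    gap mu phi (u t) `^ r <= C / kappa * \int[mu]_x dissip (u t) x) ->
  forall t : R, 0 <= t ->
  (F (u t) <= (decay_rate a (kappa / C) (fine (F u0)) t)%:E)%E.
Proof.
move=> C0 su du ineq t t0.
have u_ge0 s : 0 <= s -> forall x, 0 <= u s x by move=> s0 x; exact: (pme_ge0 su).
have FE s : 0 <= s -> F (u s) = (gap mu phi (u s))%:E.
  by move=> s0; apply: F_gap; [exact: u_ge0|exact: (pme_integrable su)|exact: (df_integrable du)].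
(* The subtracted term is written with the initial mass, so that it is constant in [s] and
   disappears on differentiation. *)
pose y s := \int[mu]_x phi (u s x) - phi (\int[mu]_x u0 x).
have yE s : 0 <= s -> gap mu phi (u s) = y s.
  by move=> s0; rewrite /gap /y (pme_mass su s0).
rewrite -(pme_init su) !FE// !yE// lee_fin.
apply: (@le_decay_rate _ a (kappa / C) y (fun s => - (\int[mu]_x dissip (u s) x))) => //.
- by rewrite divr_ge0// ltW.
- move=> s s0; rewrite -yE//; apply: gap_ge0; [exact: u_ge0|exact: (pme_integrable su)|exact: (df_integrable du)].
- move=> s s0; rewrite -[X in is_derive _ _ _ X]subr0; apply: is_deriveB.
  rewrite -(df_symmetry du s0); have := df_derive du s0; congr is_derive.
  by apply: eq_Rintegral => x _; rewrite (pme_eq su).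
- move=> s s0; rewrite lerN2 -yE ?(ltW s0)// -rE -ler_pdivlMl ?divr_gt0// invf_div.
  exact: ineq.
- by apply: cvgB; [exact: (df_cvg0 du)|exact: cvg_cst].
Qed.

Definition Lq_inequality (C : R) : Prop :=
  forall f : 'rV[R]_d -> R, C1 f -> (forall x, 0 <= f x) ->
  (F (fun x => (f x `^ p)%R) `^ r <= C%:E * \int[mu]_x (energy f x)%:E)%E.

(** For [1 <= p^-1] the function u^(1/p) is C1 even where [u] vanishes, so the inequality applies to
    it directly, and its energy density is the dissipation divided by [kappa] at every point. *)
Lemma dissipation_ineq_ge1 C (u : 'rV[R]_d -> R) : 0 < C -> 1 <= p^-1 -> Lq_inequality C ->
  C1 u -> (forall x, 0 <= u x) -> mu.-integrable setT (EFin \o u) ->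
  mu.-integrable setT (EFin \o (phi \o u)) ->
  mu.-integrable setT (EFin \o dissip u) ->
  gap mu phi u `^ r <= C / kappa * \int[mu]_x dissip u x.
Proof.
move=> C0 p1 ineq uC1 u0 iu ip iI.
have [fC1 fE] := C1_powR_ge1 p1 uC1 u0.
have := ineq _ fC1 (fun x => powR_ge0 _ _).
rewrite (_ : (fun x => _) = u); last first.
  by apply/funext => x; rewrite -powRrM mulVf ?gt_eqF// powRr1.
rewrite (F_gap u0 iu ip) poweR_EFin.
have energyE x : energy (fun x => u x `^ p^-1) x = kappa^-1 * dissip u x.
  rewrite /energy fE dotvZl dotvZr mulrA -expr2.
  have := u0 x; rewrite le_eqVlt => /predU1P[ux|ux].
    rewrite (dissip_eq0 uC1 u0 (esym ux)) mulr0.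
    by rewrite (grad_min0 u0 (esym ux) (proj1 uC1 x)) dotv0r mulr0.
  by rewrite (dissip_gt0 (proj1 uC1 x) ux) mulrA mulKf ?gt_eqF.
rewrite (_ : integral _ _ _ = (kappa^-1 * \int[mu]_x dissip u x)%:E).
  by rewrite -EFinM lee_fin mulrA.
under eq_integral do rewrite energyE.
by rewrite EFin_Rintegral ?RintegralZl//; exact: (integrableZl measurableT kappa^-1 iI).
Qed.

Lemma le_powR_root (y L : R) : 0 <= y -> y `^ r <= L -> y <= L `^ r^-1.
Proof.
move=> y0 yL; rewrite -[leLHS](powRr1 y0) -(@divff _ r) ?gt_eqF// powRrM.
by rewrite ge0_ler_powR ?nnegrE ?invr_ge0 ?powR_ge0 ?(le_trans _ yL) ?powR_ge0// ltW.
Qed.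

Lemma powR_root_le (y L : R) : 0 <= y -> 0 <= L -> y <= L `^ r^-1 -> y `^ r <= L.
Proof.
move=> y0 L0 yL; rewrite -[leRHS](powRr1 L0) -(@mulVf _ r) ?gt_eqF// powRrM.
by rewrite ge0_ler_powR ?nnegrE ?powR_ge0// ltW.
Qed.

(** Semicontinuity is applied to the gap itself, with the bound L^(1/r), and the power [r] is
    restored afterwards. A limit of mean 0, not covered by [gap_lsc], has gap 0. *)
Lemma gap_le_of_approx (g_ : nat -> 'rV[R]_d -> R) (g : 'rV[R]_d -> R) (c L : R) :
  (forall n, mu.-integrable setT (EFin \o g_ n)) ->
  (forall n, mu.-integrable setT (EFin \o (phi \o g_ n))) ->
  measurable_fun setT g ->
  (forall n x, 0 <= g_ n x <= c * (g x + 1)) -> (forall x, 0 <= g x) ->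
  (forall x, g_ n x @[n --> \oo] --> g x) ->
  (forall n, 0 < \int[mu]_x g_ n x) ->
  (forall n, gap mu phi (g_ n) `^ r <= L) ->
  [/\ mu.-integrable setT (EFin \o g), mu.-integrable setT (EFin \o (phi \o g)) &
    gap mu phi g `^ r <= L].
Proof.
move=> ig ip mg gb g0 gcvg M0 gapL.
have gn0 n x : 0 <= g_ n x by have /andP[] := gb n x.
have L0 : 0 <= L := le_trans (powR_ge0 _ _) (gapL 0%N).
have gapK n : gap mu phi (g_ n) <= L `^ r^-1 by apply: le_powR_root => //; exact: gap_ge0.
have [igg H] := gap_lsc mu1 bregman_ge0 bregman_unbounded cphi cdphi ig ip mg gb g0 gcvg M0 gapK.
have : 0 <= \int[mu]_x g x by exact: Rintegral_ge0.
rewrite le_eqVlt => /predU1P[M|/H[ipg gapg]].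
  have [ipg] := mean0_comp g0 igg (esym M) (continuous_measurable_fun cphi) phi0.
  by split=> //; rewrite /gap -M phi0 b subr0 powR0// gt_eqF.
by split=> //; apply: powR_root_le => //; exact: gap_ge0.
Qed.

(** Since 1/p - 1 <= 0, one has (u + e)^(1/p - 1) <= u^(1/p - 1) where [u] is positive, and grad u =
    0 elsewhere. Hence the energy of (u + e)^(1/p) is at most the dissipation of [u] over [kappa], a
    bound free of [e] that survives the limit. *)
Lemma dissipation_ineq_le1 C (u : 'rV[R]_d -> R) : 0 < C -> p^-1 <= 1 -> Lq_inequality C ->
  (forall e : R, 0 < e -> mu.-integrable setT (EFin \o (phi \o (fun x => u x + e)))) ->
  C1 u -> (forall x, 0 <= u x) -> mu.-integrable setT (EFin \o u) ->
  mu.-integrable setT (EFin \o dissip u) ->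
  gap mu phi u `^ r <= C / kappa * \int[mu]_x dissip u x.
Proof.
move=> C0 p1 ineq ipe uC1 u0 iu iI.
pose e n : R := n.+1%:R^-1.
have e0 n : 0 < e n by rewrite invr_gt0.
have iue n : mu.-integrable setT (EFin \o (fun x => u x + e n)).
  exact: (integrableD measurableT iu (integrable_cst mu1 (e n))).
have uM : \int[mu]_x u x >= 0 by exact: Rintegral_ge0.
have [] := @gap_le_of_approx (fun n x => u x + e n) u 1 (C / kappa * \int[mu]_x dissip u x) => //.
- by move=> n; exact: ipe.
- by apply/measurable_EFinP; exact: (measurable_int mu iu).
- move=> n x; rewrite mul1r addr_ge0 ?(ltW (e0 n))//= lerD2l.
  by rewrite invf_le1// ler1n.
- move=> x; rewrite -[X in _ --> X]addr0; apply: cvgD; first exact: cvg_cst.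
  exact: cvg_harmonic.
- move=> n; rewrite RintegralD//; last exact: (integrable_cst mu1 (e n)).
  by rewrite (Rintegral_cst1 mu1) ltr_wpDl.
- move=> n; pose h s := (s + e n) `^ p^-1.
  have ue0 x : 0 < u x + e n by rewrite ltr_wpDl.
  have hd x : is_derive (u x) 1 h (p^-1 * (u x + e n) `^ (p^-1 - 1)).
    rewrite -[X in is_derive _ _ _ X]mulr1.
    apply: (@is_derive1_comp _ (powR (R:=R) ^~ p^-1) (fun s => s + e n)).
      exact: is_derive1_powR.
    by rewrite -[X in is_derive _ _ _ X]addr0; apply: is_deriveD.
  have hc x : {for u x, continuous (fun s => p^-1 * (s + e n) `^ (p^-1 - 1))}.
    apply: (@continuousM _ _ (cst p^-1) _ (u x)); first exact: cst_continuous.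
    apply: (@continuous_comp _ _ _ (fun s => s + e n) (powR (R:=R) ^~ (p^-1 - 1))).
      by apply: continuousD; [exact: id|exact: cst_continuous].
    exact: (is_derive1_continuous (is_derive1_powR _ (ue0 x))).
  have [fC1 fE] := C1_comp uC1 hd hc.
  have := ineq _ fC1 (fun x => powR_ge0 _ _).
  rewrite (_ : (fun x => _) = fun x => u x + e n); last first.
    by apply/funext => x; rewrite /h/= -powRrM mulVf ?gt_eqF// powRr1// ltW.
  rewrite F_gap//; [|by move=> x; exact: ltW|exact: ipe].
  rewrite poweR_EFin => /le_trans; rewrite -lee_fin; apply.
  rewrite -mulrA EFinM; apply: lee_wpmul2l; first by rewrite lee_fin ltW.
  rewrite -(RintegralZl _ measurableT iI) -EFin_Rintegral; last first.
    exact: (integrableZl measurableT kappa^-1 iI).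
  apply: ge0_le_integral => //.
  + by move=> x _; rewrite lee_fin dotv_ge0.
  + by apply/measurable_EFinP; exact: C1_measurable_grad.
  + by apply: (measurable_int mu); exact: (integrableZl measurableT kappa^-1 iI).
  move=> x _; rewrite lee_fin /energy fE dotvZl dotvZr mulrA -expr2.
  have := u0 x; rewrite le_eqVlt => /predU1P[ux|ux].
    rewrite (dissip_eq0 uC1 u0 (esym ux)) mulr0.
    by rewrite (grad_min0 u0 (esym ux) (proj1 uC1 x)) dotv0r mulr0.
  rewrite (dissip_gt0 (proj1 uC1 x) ux) mulrA mulKf ?gt_eqF//.
  rewrite ler_wpM2r ?dotv_ge0// lerXn2r ?nnegrE ?mulr_ge0 ?invr_ge0 ?powR_ge0 ?(ltW p_gt0)//.
  rewrite ler_wpM2l ?invr_ge0 ?(ltW p_gt0)//.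
  rewrite -(opprB 1 p^-1) !powRN lef_pV2 ?posrE ?powR_gt0//.
  by rewrite ge0_ler_powR ?nnegrE ?subr_ge0 ?(ltW (ue0 x)) ?(ltW ux)// lerDl ltW.
Qed.

(* Both sides of the decay estimate agree at [t = 0], so it also compares their
   right derivatives there. *)
Lemma Lq_of_decay_bounded C (f : 'rV[R]_d -> R) (c B : R) u : 0 < C -> 0 < c ->
  C1 f -> (forall x, c <= f x <= B) ->
  mu.-integrable setT (EFin \o energy f) ->
  pme_solution psiC2 m (fun x => f x `^ p) u ->
  differentiable_functional psiC2 m phi dphi u ->
  (forall t : R, 0 <= t ->
    (F (u t) <= (decay_rate a (kappa / C) (fine (F (fun x => f x `^ p)%R)) t)%:E)%E) ->
  gap mu phi (fun x => f x `^ p) `^ r <= C * \int[mu]_x energy f x.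
Proof.
move=> C0 c0 fC1 fB iE su du dec.
set u0 := (fun x => f x `^ p) in su dec *.
have f0 x : 0 < f x by have /andP[cf _] := fB x; exact: lt_le_trans cf.
have u00 x : 0 < u0 x by exact: powR_gt0.
have u0C1 : C1 u0 by exact: C1_powR_gt0.
have uu0 : u 0 = u0 := pme_init su.
have fu x : f x = u0 x `^ p^-1 by rewrite -powRrM divff ?gt_eqF// powRr1// ltW.
(* The datum is f^p, so its power 1/p is [f] again. The identity also transfers integrability from
   the energy to the dissipation, as the right derivative at time 0 requires. *)
have disE x : dissip (u 0) x = kappa * energy f x.
  rewrite uu0 (dissip_gt0 (proj1 u0C1 x) (u00 x)) /energy.
  rewrite (_ : f = fun y => u0 y `^ p^-1); last exact/funext.
  by rewrite (grad_powR_gt0 _ (proj1 u0C1 x) (u00 x)) dotvZl dotvZr; ring.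
have idis : mu.-integrable setT (EFin \o dissip (u 0)).
  rewrite (_ : EFin \o _ = (fun x => kappa%:E * (EFin \o energy f) x)%E).
    exact: integrableZl.
  by apply/funext => x /=; rewrite disE EFinM.
have u_ge0 s : 0 <= s -> forall x, 0 <= u s x by move=> s0 x; exact: (pme_ge0 su).
have FE s : 0 <= s -> F (u s) = (gap mu phi (u s))%:E.
  by move=> s0; apply: F_gap; [exact: u_ge0|exact: (pme_integrable su)|exact: (df_integrable du)].
have gap0 : 0 <= gap mu phi u0.
  rewrite -uu0; apply: gap_ge0; [exact: u_ge0|exact: (pme_integrable su)|exact: (df_integrable du)].
have E0 : 0 <= \int[mu]_x energy f x by apply: Rintegral_ge0 => x _; exact: dotv_ge0.
(* A zero initial gap makes the claim trivial; the slope of [decay_rate] at 0 is available for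
   positive initial values. *)
move: gap0; rewrite le_eqVlt => /predU1P[<-|y0].
  by rewrite powR0 ?gt_eqF// mulr_ge0// ltW.
have := df_right_derive0 du; rewrite uu0 => /(_ u0C1 u00); rewrite -uu0 => /(_ idis) H.
have H' := @decay_rate_right_derivative _ a (kappa / C) _ a_ge0 y0.
have le_rates : - (\int[mu]_x dissip (u 0) x) <= - (kappa / C * gap mu phi u0 `^ (1 + a)).
  apply: (ler_cvg_to H H'); near=> h.
  have h0 : 0 < h by near: h; exact: nbhs_right_gt.
  rewrite ler_pM2l ?invr_gt0//.
  have := dec _ (ltW h0); rewrite -uu0 !FE ?(ltW h0)// lee_fin /= => dech.
  have gE s : 0 <= s -> gap mu phi (u s) = \int[mu]_x phi (u s x) - phi (\int[mu]_x u0 x).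
    by move=> s0; rewrite /gap (pme_mass su s0).
  have := lerD dech (lexx (- gap mu phi (u 0))).
  rewrite [in leLHS]gE ?(ltW h0)// [in leLHS]gE// uu0.
  by rewrite opprB addrA subrK.
have disI : \int[mu]_x dissip (u 0) x = kappa * \int[mu]_x energy f x.
  by rewrite -RintegralZl//; apply: eq_Rintegral => x _; rewrite disE.
move: le_rates; rewrite lerN2 disI -mulrA ler_pM2l// rE uu0.
by rewrite mulrC ler_pdivrMr// mulrC.
Unshelve. all: by end_near. Qed.


(** An infinite energy leaves nothing to prove. Otherwise the truncations of [f] have energy at most
    that of [f], so their gaps share one bound. *)
Lemma Lq_of_bounded C : 0 < C ->
  (forall (f : 'rV[R]_d -> R) (c B : R), 0 < c -> C1 f ->
    (forall x, c <= f x <= B) -> mu.-integrable setT (EFin \o energy f) ->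
    gap mu phi (fun x => f x `^ p) `^ r <= C * \int[mu]_x energy f x) ->
  Lq_inequality C.
Proof.
move=> C0 H f fC1 f0.
have mE g : C1 g -> measurable_fun setT (EFin \o energy g).
  by move=> gC1; apply/measurable_EFinP; exact: C1_measurable_grad.
have E0 g x : (0 <= (energy g x)%:E)%E by rewrite lee_fin dotv_ge0.
have [Eoo|Efin] := eqVneq (\int[mu]_x (energy f x)%:E)%E +oo%E.
  by rewrite Eoo gt0_muley ?lte_fin// leey.
have iE : mu.-integrable setT (EFin \o energy f).
  apply/integrableP; split; first exact: mE.
  rewrite (_ : (fun _ => _) = fun x => (energy f x)%:E); first by rewrite ltey.
  by apply/funext => x /=; rewrite ger0_norm ?dotv_ge0.
pose e n : R := n.+1%:R^-1.
have e0 n : 0 < e n by rewrite invr_gt0.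
have e1 n : e n <= 1 by rewrite invf_le1// ler1n.
pose f_ n x := truncation (e n) (f x).
have fC n : C1 (f_ n) := (C1_truncation (e0 n) fC1 f0).1.
have fle n x : energy (f_ n) x <= energy f x := (C1_truncation (e0 n) fC1 f0).2 x.
have fb n x : truncation (e n) 0 <= f_ n x <= (e n)^-1.
  by have /andP[-> /=] := truncation_bounds (e0 n) (f0 x); rewrite le_min => /andP[].
have f_gt0 n x : 0 < f_ n x.
  by apply: (lt_le_trans (truncation0_gt0 (e0 n))); have /andP[] := fb n x.
have fle1 n x : f_ n x <= f x + 1.
  have /andP[_] := truncation_bounds (e0 n) (f0 x); rewrite le_min => /andP[_] /le_trans; apply.
  by rewrite lerD2l.
have mf n : measurable_fun setT (fun x => f_ n x `^ p).
  by apply: continuous_rV_measurable; apply: C1_continuous; exact: C1_powR_gt0.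
have pb n x : 0 <= f_ n x `^ p <= (e n)^-1 `^ p.
  rewrite powR_ge0/= ge0_ler_powR ?nnegrE ?invr_ge0 ?(ltW p_gt0) ?(ltW (e0 n)) ?(ltW (f_gt0 n x))//.
  by have /andP[] := fb n x.
have iEn n : mu.-integrable setT (EFin \o energy (f_ n)).
  apply: le_integrable iE => //; first exact: mE.
  by move=> x _ /=; rewrite lee_fin !ger0_norm ?dotv_ge0//; exact: fle.
have ip n : mu.-integrable setT (EFin \o (fun x => f_ n x `^ p)).
  apply: (integrable_bounded mu1 (mf n) (B := (e n)^-1 `^ p)) => x.
  by rewrite ger0_norm ?powR_ge0//; have /andP[] := pb n x.
have gapL n : gap mu phi (fun x => f_ n x `^ p) `^ r <= C * \int[mu]_x energy f x.
  apply: le_trans (H _ _ _ (truncation0_gt0 (e0 n)) (fC n) (fb n) (iEn n)) _.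
  by rewrite ler_pM2l// le_Rintegral.
have [||||||ig ipg gapg] := @gap_le_of_approx (fun n x => f_ n x `^ p) (fun x => f x `^ p)
  (2 `^ p) (C * \int[mu]_x energy f x) ip _ _ _ _ _ _ gapL.
- by move=> n; exact: (integrable_continuous_bounded mu1 cphi (mf n) (pb n)).
- rewrite (_ : (fun x => _) = (fun s : R => `|s| `^ p) \o f); last first.
    by apply/funext => x /=; rewrite ger0_norm.
  apply: continuous_rV_measurable => x; apply: continuous_comp; first exact: C1_continuous.
  exact: continuous_normr_powR (ltW p_gt0) _.
- move=> n x; rewrite powR_ge0/=.
  have fx1 : 0 <= f x + 1 by rewrite addr_ge0.
  apply: (@le_trans _ _ ((f x + 1) `^ p)).
    by rewrite ge0_ler_powR ?nnegrE ?(ltW p_gt0) ?(ltW (f_gt0 n x)).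
  (* The factor 2^p comes from f + 1 <= 2 max(1, f). *)
  have [fx|fx] := leP (f x) 1.
    apply: (@le_trans _ _ (2 `^ p)).
      by rewrite ge0_ler_powR ?nnegrE ?(ltW p_gt0)//; lra.
    by rewrite ler_peMr ?powR_ge0// lerDr powR_ge0.
  apply: (@le_trans _ _ ((2 * f x) `^ p)).
    rewrite ge0_ler_powR ?nnegrE ?(ltW p_gt0) ?mulr_ge0//; lra.
  by rewrite powRM// ler_wpM2l ?powR_ge0// lerDl.
- by move=> x; exact: powR_ge0.
- move=> x; rewrite -(ger0_norm (f0 x)).
  rewrite (_ : (fun n => _) = fun n => `|f_ n x| `^ p); last first.
    by apply/funext => n; rewrite gtr0_norm.
  exact: (continuous_cvg _ (@continuous_normr_powR _ p (ltW p_gt0) (f x)) (cvg_truncation (f0 x))).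
- move=> n; apply: (@lt_le_trans _ _ (truncation (e n) 0 `^ p)).
    by rewrite powR_gt0// truncation0_gt0.
  rewrite -[leLHS](Rintegral_cst1 mu1); apply: le_Rintegral => //; first exact: integrable_cst.
  move=> x _; rewrite ge0_ler_powR ?nnegrE ?(ltW p_gt0) ?(ltW (truncation0_gt0 (e0 n))) ?(ltW (f_gt0 n x))//.
  by have /andP[] := fb n x.
rewrite F_gap ?poweR_EFin; [|by move=> x; exact: powR_ge0|exact: ig|exact: ipg].
by rewrite (EFin_Rintegral iE) -EFinM lee_fin.
Qed.

End decay_equivalence.

(** From above, s (ln (s + e) - ln s) <= e and e ln (s + e) <= e (s + e); from below, s ln s + e ln
    e <= (s + e) ln (s + e). The bound is affine in [s] and |s ln s|, hence integrable along a
    density of finite entropy. *)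
Lemma xlnx_shift_le (R : realType) (s e : R) : 0 <= s -> 0 < e ->
  `|xlnx (s + e)| <= `|xlnx s| + (`|xlnx e| + e * (1 + e + s)).
Proof.
move=> s0 e0; have se0 : 0 < s + e by rewrite ltr_wpDl.
have lnB : ln (s + e) <= s + e by rewrite ltW// ln_sublinear.
have up : xlnx (s + e) <= xlnx s + e * (1 + e + s).
  move: s0; rewrite le_eqVlt => /predU1P[s_0|s0].
    rewrite /xlnx -s_0 mul0r !add0r addr0 ler_wpM2l ?(ltW e0)//.
    by move: lnB; rewrite -s_0 add0r => /le_trans; apply; rewrite lerDr.
  have lnD : ln (s + e) - ln s <= e / s.
    rewrite -ln_div ?posrE// mulrDl divff ?gt_eqF//.
    by apply: le_ln1Dx; rewrite (lt_trans (ltrN10 _))// divr_gt0.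
  have : s * (ln (s + e) - ln s) <= e.
    by rewrite -ler_pdivlMl// mulrC.
  by rewrite /xlnx; nra.
have lo : xlnx s + xlnx e <= xlnx (s + e).
  rewrite /xlnx mulrDl lerD//; last first.
    by rewrite ler_wpM2l ?(ltW e0)// ler_ln ?posrE// lerDr.
  move: s0; rewrite le_eqVlt => /predU1P[<-|s0]; first by rewrite !mul0r.
  by rewrite ler_wpM2l ?(ltW s0)// ler_ln ?posrE// lerDl ltW.
have h : 0 <= e * (1 + e + s) by rewrite mulr_ge0 ?(ltW e0)// !addr_ge0// ltW.
have := ler_norm (xlnx s); have := ler_norm (xlnx e).
have := ler_norm (- xlnx s); have := ler_norm (- xlnx e); rewrite !normrN => a b c d.
by rewrite ler_norml; apply/andP; split; lra.
Qed.

Section integrable_shift.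
Context (dT : measure_display) (T : measurableType dT) (R : realType).
Variable mu : {measure set T -> \bar R}.
Hypothesis mu1 : mu setT = 1%E.

Lemma integrable_xlnx_shift (g : T -> R) (e : R) : 0 < e -> (forall x, 0 <= g x) ->
  mu.-integrable setT (EFin \o g) -> mu.-integrable setT (EFin \o (@xlnx R \o g)) ->
  mu.-integrable setT (EFin \o (@xlnx R \o (fun x => g x + e))).
Proof.
move=> e0 g0 ig ip.
have mg : measurable_fun setT g by apply/measurable_EFinP; exact: (measurable_int mu ig).
have idom : mu.-integrable setT
    (EFin \o (fun x => `|xlnx (g x)| + (`|xlnx e| + e * (1 + e + g x)))).
  rewrite (_ : EFin \o _ = ((fun x => `|(EFin \o (@xlnx R \o g)) x|) \+
    ((EFin \o cst `|xlnx e|%R) \+ (fun x => e%:E * ((EFin \o cst (1 + e)%R) \+ (EFin \o g)) x)))%E); last first.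
    by apply/funext => x.
  apply: integrableD => //; first exact: integrable_norm.
  apply: integrableD => //; first exact: integrable_cst.
  by apply: integrableZl => //; apply: integrableD => //; exact: integrable_cst.
apply: le_integrable idom => //.
  apply/measurable_EFinP; apply: measurableT_comp; last exact: measurable_funD.
  by apply: continuous_measurable_fun; exact: continuous_xlnx.
by move=> x _ /=; rewrite lee_fin (le_trans (xlnx_shift_le (g0 x) e0))// ler_norm.
Qed.

End integrable_shift.

(** * Matching the explicit constants *)

Section rates.
Variable R : realType.
Implicit Types m C V t s : R.

(** The coefficient of t / C is a kappa, that is (m-1)/2 times 8m/(m+1)^2, and [kappa] is 2 at m =
    1. *)
Lemma var_boundE m C V t : 1 <= m -> 0 < C ->
  var_bound m C V t = decay_rate ((m - 1) / 2) (8 * m / (m + 1) ^+ 2 / C) V t.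
Proof.
move=> m1 C0; rewrite /var_bound /decay_rate; case: ifP => // _.
have mp : m + 1 != 0 by rewrite gt_eqF//; lra.
have -> : ((m - 1) / 2 == 0) = (m == 1).
  by rewrite mulf_eq0 invr_eq0 pnatr_eq0 orbF subr_eq0.
case: eqP => [->|/eqP mN1].
  by congr (expR (- _) * _); field; rewrite gt_eqF.
have mN0 : m - 1 != 0 by rewrite subr_eq0.
congr ((_ + _) `^ (- _)); first by field; rewrite gt_eqF// mp.
by field.
Qed.

(** Here a kappa is (m - 1) times 4/m, and [kappa] is 4 at m = 1. *)
Lemma ent_boundE m C V t : 1 <= m -> 0 < C ->
  ent_bound m C V t = decay_rate (m - 1) (4 / m / C) V t.
Proof.
move=> m1 C0; rewrite /ent_bound /decay_rate; case: ifP => // _.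
have mp : m != 0 by rewrite gt_eqF//; lra.
rewrite subr_eq0; case: eqP => [->|/eqP mN1].
  by congr (expR (- _) * _); field; rewrite gt_eqF.
by rewrite opprB div1r; congr ((_ + _) `^ _); field; rewrite gt_eqF.
Qed.

Lemma var_dissipation m s : 1 <= m -> 0 < s ->
  2 * (m * s `^ (m - 1)) =
  8 * m / (m + 1) ^+ 2 * ((2 / (m + 1))^-1 * s `^ ((2 / (m + 1))^-1 - 1)) ^+ 2.
Proof.
move=> m1 s0; have mp : m + 1 != 0 by rewrite gt_eqF//; lra.
have -> : m - 1 = ((2 / (m + 1))^-1 - 1) * 2%:R by field.
by rewrite powRrM powR_mulrn ?powR_ge0//; field.
Qed.

Lemma ent_dissipation m s : 1 <= m -> 0 < s ->
  s^-1 * (m * s `^ (m - 1)) =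
  4 / m * ((2 * (1 / m))^-1 * s `^ ((2 * (1 / m))^-1 - 1)) ^+ 2.
Proof.
move=> m1 s0; have mp : m != 0 by rewrite gt_eqF//; lra.
have -> : s `^ (m - 1) = s * (s `^ ((2 * (1 / m))^-1 - 1)) ^+ 2.
  rewrite -{2}[s]powRr1 ?ltW// -powR_mulrn ?powR_ge0// -powRrM -powRD ?(gt_eqF s0) ?implybT//.
  by congr (_ `^ _); field.
by field; rewrite mp gt_eqF.
Qed.

End rates.

Theorem theorem4p5 (R : realType) (d : nat) (m : R) (m_ge1 : 1 <= m)
    (psi : 'rV[R]_d -> R) (psiC2 : C2 psi)
    (Z_fin : (partition_function psi < +oo)%E)
    (adm : set ('rV[R]_d -> R)) (fw : pme_framework psiC2 m adm) :
  (forall C_P : R, 0 < C_P ->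
     (Lq_poincare (gibbs psiC2) (2 / (m + 1)) C_P -> var_decay psiC2 m adm C_P)
     /\
     (var_decay psiC2 m adm C_P -> Lq_poincare (gibbs psiC2) (2 / (m + 1)) C_P))
  /\
  (forall C_LS : R, 0 < C_LS ->
     (Lq_logsobolev (gibbs psiC2) (1 / m) C_LS -> ent_decay psiC2 m adm C_LS)
     /\
     (ent_decay psiC2 m adm C_LS -> Lq_logsobolev (gibbs psiC2) (1 / m) C_LS)).
Proof.
have m0 : 0 < m by lra.
have mp : m + 1 != 0 by rewrite gt_eqF//; lra.
have mu1 := gibbs_setT psiC2 Z_fin.
(* Data f^p with [f] between positive constants are positive, C1 and bounded, hence in every
   Lebesgue space of the probability measure: the framework provides their solution. *)
have bounded_datum (p : R) (f : 'rV[R]_d -> R) c B : 0 < p -> 0 < c -> C1 f ->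
    (forall x, c <= f x <= B) ->
    [/\ C1 (fun x => f x `^ p), forall x, 0 < f x `^ p,
      measurable_fun setT (fun x => f x `^ p) & forall x, 0 <= f x `^ p <= B `^ p].
  move=> p0 c0 fC1 fB.
  have f0 x : 0 < f x by have /andP[cf _] := fB x; exact: lt_le_trans cf.
  have uC1 := C1_powR_gt0 p fC1 f0.
  split=> //; first by move=> x; exact: powR_gt0.
    by apply: continuous_rV_measurable; exact: C1_continuous.
  move=> x; rewrite powR_ge0/=; have /andP[_ fxB] := fB x.
  by rewrite ge0_ler_powR ?nnegrE ?(ltW p0) ?(ltW (f0 x))// (le_trans _ fxB)// ltW.
have Lf (p : R) (u0 : 'rV[R]_d -> R) B : 1 <= p -> measurable_fun setT u0 ->
    (forall x, 0 <= u0 x <= B) -> u0 \in Lfun (gibbs psiC2) p%:E.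
  move=> p1 mu0 u0B; apply: (Lfun_bounded mu1 p1 mu0 (B := B)) => x.
  by have /andP[? ?] := u0B x; rewrite ger0_norm.
split=> C C0.
  have p0 : 0 < 2 / (m + 1) by rewrite divr_gt0//; lra.
  have k0 : 0 < 8 * m / (m + 1) ^+ 2 by rewrite divr_gt0 ?exprn_gt0 ?mulr_gt0//; lra.
  have a0 : 0 <= (m - 1) / 2 by lra.
  have rE : (2 / (m + 1))^-1 = 1 + (m - 1) / 2 by field.
  have Fg (g : 'rV[R]_d -> R) : (forall x, 0 <= g x) ->
      (gibbs psiC2).-integrable setT (EFin \o g) ->
      (gibbs psiC2).-integrable setT (EFin \o (@sqr_fun R \o g)) ->
      Var (gibbs psiC2) g = (gap (gibbs psiC2) (@sqr_fun R) g)%:E.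
    by move=> _; exact: Var_gap.
  have phi0 : sqr_fun 0 = 0 :> R by rewrite /sqr_fun expr0n.
  have cphi : continuous (@sqr_fun R) by exact: exprn_continuous.
  have dd (s : R) : 0 < s -> is_derive s 1 (fun t : R => 2 * t) (2 : R).
    by move=> _; rewrite -[X in is_derive _ _ _ X]mulr1; exact: is_deriveZ.
  have D0 (s M : R) : 0 <= s -> 0 < M -> 0 <= bregman (@sqr_fun R) (fun t => 2 * t) s M.
    by move=> _ _; rewrite bregman_sqr sqr_ge0.
  have dis (s : R) := @var_dissipation R m s m_ge1.
  split=> [ineq u0 u _ u0L su t t0|dec].
    rewrite var_boundE//; have du := pme_var su u0L.
    apply: (decay_of_dissipation Z_fin Fg phi0 cphi D0 k0 a0 rE C0 su du _ t0) => s s0.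
    apply: (dissipation_ineq_ge1 m_ge1 Fg dd p0 k0 dis C0 _ ineq) => //.
    (* For the variance 1/p is also [r], so it is at least 1 for every [m] and no shift of the
       density is called for. *)
    - by rewrite rE lerDl.
    - exact: (pme_C1 su).
    - by move=> x; apply: (pme_ge0 su); exact: ltW.
    - by apply: (pme_integrable su); exact: ltW.
    - by apply: (df_integrable du); exact: ltW.
    - exact: (df_grad_integrable du).
  apply: (Lq_of_bounded Z_fin Fg phi0 cphi dd D0 (@bregman_sqr_unbounded R) p0 a0 rE C0).
  move=> f c B c0 fC1 fB iE; have [uC1 u_gt0 mu0 uB] := bounded_datum _ _ _ _ p0 c0 fC1 fB.
  have uadm : adm (fun x => f x `^ (2 / (m + 1))).
    by apply: (pme_adm fw) => //; apply: (Lf (m + 1)) => //; lra.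
  have [u su] := pme_existence fw uadm.
  have u2 : (fun x => f x `^ (2 / (m + 1))) \in Lfun (gibbs psiC2) 2%:E.
    by apply: (Lf 2) uB => //; lra.
  apply: (Lq_of_decay_bounded Z_fin Fg phi0 cphi dd D0 p0 k0 a0 rE dis C0 c0 fC1 fB iE su
    (pme_var su u2)) => t t0.
  by rewrite -var_boundE//; exact: dec.
have p0 : 0 < 2 * (1 / m) by rewrite mulr_gt0// divr_gt0.
have k0 : 0 < 4 / m by rewrite divr_gt0.
have a0 : 0 <= m - 1 by lra.
have rE : (1 / m)^-1 = 1 + (m - 1) by field; rewrite gt_eqF.
have Fg (g : 'rV[R]_d -> R) : (forall x, 0 <= g x) ->
    (gibbs psiC2).-integrable setT (EFin \o g) ->
    (gibbs psiC2).-integrable setT (EFin \o (@xlnx R \o g)) ->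
    Ent (gibbs psiC2) g = (gap (gibbs psiC2) (@xlnx R) g)%:E.
  exact: Ent_gap.
have phi0 : xlnx 0 = 0 :> R by rewrite /xlnx mul0r.
have cphi := @continuous_xlnx R.
have dd (s : R) : 0 < s -> is_derive s 1 (fun t : R => ln t + 1) s^-1.
  move=> s0; rewrite -[X in is_derive _ _ _ X]addr0; apply: is_deriveD.
  exact: is_derive1_ln.
have D0 (s M : R) : 0 <= s -> 0 < M -> 0 <= bregman (@xlnx R) (fun t => ln t + 1) s M.
  by move=> s0 M0; exact: le_trans (sqr_ge0 _) (bregman_xlnx_ge s0 M0).
have dis (s : R) := @ent_dissipation R m s m_ge1.
split=> [ineq u0 u _ u0E su t t0|dec].
  rewrite ent_boundE//; have du := pme_ent su u0E.
  apply: (decay_of_dissipation Z_fin Fg phi0 cphi D0 k0 a0 rE C0 su du _ t0) => s s0.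
  have u_ge0 x : 0 <= u s x by apply: (pme_ge0 su); exact: ltW.
  have iu := pme_integrable su (ltW s0); have iphi := df_integrable du (ltW s0).
  have iI := df_grad_integrable du s0.
  (* For the entropy 1/p is m/2: the direct argument covers [2 <= m], the shifted density the
     rest. *)
  have [p1|/ltW p1] := leP 1 (2 * (1 / m))^-1.
    apply: (dissipation_ineq_ge1 m_ge1 Fg dd p0 k0 dis C0 p1 ineq) => //.
    exact: (pme_C1 su).
  apply: (dissipation_ineq_le1 Z_fin m_ge1 Fg phi0 cphi dd D0
    (@bregman_xlnx_unbounded R) p0 k0 a0 rE dis C0 p1 ineq) => //.
    by move=> e e0; exact: integrable_xlnx_shift.
  exact: (pme_C1 su).
apply: (Lq_of_bounded Z_fin Fg phi0 cphi dd D0 (@bregman_xlnx_unbounded R) p0 a0 rE C0).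
move=> f c B c0 fC1 fB iE; have [uC1 u_gt0 mu0 uB] := bounded_datum _ _ _ _ p0 c0 fC1 fB.
have uadm : adm (fun x => f x `^ (2 * (1 / m))).
  by apply: (pme_adm fw) => //; apply: (Lf (m + 1)) => //; lra.
have [u su] := pme_existence fw uadm.
have uE : (Ent (gibbs psiC2) (fun x => (f x `^ (2 * (1 / m)))%R) < +oo)%E.
  rewrite Fg ?ltry//; first by move=> x; exact: ltW.
    apply: (integrable_continuous_bounded mu1 (phi := id) _ mu0 uB).
    by move=> ?; exact: id.
  exact: (integrable_continuous_bounded mu1 cphi mu0 uB).
apply: (Lq_of_decay_bounded Z_fin Fg phi0 cphi dd D0 p0 k0 a0 rE dis C0 c0 fC1 fB iE su
  (pme_ent su uE)) => t t0.
by rewrite -ent_boundE//; exact: dec.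
Qed.
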